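(* Let $\psi\in\mathcal H=L^2(\mathbb{R}^2_\ast,\mathrm d^2\mathbf x)$ be a unit-norm admissible vector, i.e. $\|\psi\|=1$ and $\int_{\mathbb{R}^2_\ast}|\psi(\mathbf x)|^2\,\frac{\mathrm d^2\mathbf x}{x^2}<\infty$, and define on $\Gamma=\mathbb{R}^2_\ast\times\mathbb{R}^2$ the function $$\varpi_\psi(\mathbf q,\mathbf p)=\frac{\langle U(\mathbf q,\mathbf p)\psi\,|\,\psi\rangle}{q}.$$ Then the operator $$\mathsf M^{\varpi_\psi}=\int_\Gamma \mathsf C_{\mathrm{DM}}^{-1}\,U(\mathbf q,\mathbf p)\,\mathsf C_{\mathrm{DM}}^{-1}\,\varpi_\psi(\mathbf q,\mathbf p)\,\mathrm d^2\mathbf q\,\mathrm d^2\mathbf p$$ corresponding to $\varpi_\psi$ is the pure state $|\psi\rangle\langle\psi|$, and vice versa: the function corresponding to the operator $|\psi\rangle\langle\psi|$ through $\mathsf M\mapsto\frac1q\overline{\mathrm{Tr}\{U(\mathbf q,\mathbf p)\mathsf M\}}$ is $\varpi_\psi$.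
   Context: Notation. $\mathbb{R}^2_\ast=\mathbb{R}^2\setminus\{0\}$. Vectors of $\mathbb{R}^2$ are identified with complex numbers; quotients of vectors are complex ones. For a vector $\mathbf q$, $q=\|\mathbf q\|$; $\mathbf p\cdot\mathbf x$ is the Euclidean scalar product; $\langle\cdot|\cdot\rangle$ is antilinear in its first argument. The unitary irreducible representation $U$ of $\mathrm{SIM}(2)\simeq\Gamma$ on $\mathcal H$ is $(U(\mathbf q,\mathbf p)\psi)(\mathbf x)=\frac{e^{\mathrm i\mathbf p\cdot\mathbf x}}{q}\psi(\mathbf x/\mathbf q)$. The Duflo–Moore operator is $(\mathsf C_{\mathrm{DM}}\psi)(\mathbf x)=\frac{2\pi}{x}\psi(\mathbf x)$, so $(\mathsf C_{\mathrm{DM}}^{-1}\psi)(\mathbf x)=\frac{x}{2\pi}\psi(\mathbf x)$. The operator-valued integral is understood weakly, i.e. as a sesquilinear form tested on the dense subspace $C_0^\infty(\mathbb{R}^2_\ast)$. *)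

(* Defs.v *)
From HB Require Import structures.
From mathcomp Require Import all_boot all_order all_algebra.
From mathcomp Require Import all_classical all_reals all_analysis.
From mathcomp Require Import complex.

Set Implicit Arguments.
Unset Strict Implicit.
Unset Printing Implicit Defensive.

Import Order.TTheory GRing.Theory Num.Theory.
Import numFieldNormedType.Exports.
Import Normc.

Local Open Scope classical_set_scope.
Local Open Scope ring_scope.
Local Open Scope complex_scope.

Section ComplexIntegral.
Context {R : realType} {d : measure_display} {T : measurableType d}.
Variable mu : {measure set T -> \bar R}.

Definition cmeasurable_fun (D : set T) (f : T -> R[i]) : Prop :=
  measurable_fun D (fun x => complex.Re (f x)) /\
  measurable_fun D (fun x => complex.Im (f x)).

Definition cintegrable (D : set T) (f : T -> R[i]) : Prop :=
  mu.-integrable D (fun x => (complex.Re (f x))%:E) /\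
  mu.-integrable D (fun x => (complex.Im (f x))%:E).

(* Meaningful only when [cintegrable D f]: [Rintegral] is a total function. *)
Definition cintegral (D : set T) (f : T -> R[i]) : R[i] :=
  Rintegral mu D (fun x => complex.Re (f x)) +i*
  Rintegral mu D (fun x => complex.Im (f x)).

End ComplexIntegral.

Section Plane.
Variable R : realType.
Local Notation C := R[i].
Local Notation R2 := (R * R)%type.

Definition lebesgue2 := ((@lebesgue_measure R) \x (@lebesgue_measure R))%E.

HB.instance Definition _ := Measure.on lebesgue2.

Lemma sigma_finite_lebesgue2 : sigma_finite setT lebesgue2.
Proof.
have /sigma_finiteP[F [TF ndF Foo]] := sigma_finiteT (@lebesgue_measure R).
exists (fun n => F n `*` F n).
  rewrite -setXTT TF predeqE => -[x y]; split.
    move=> [/= [n _ Fnx] [k _ Fky]]; exists (maxn n k) => //; split.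
    - by move: x Fnx; exact/subsetPset/ndF/leq_maxl.
    - by move: y Fky; exact/subsetPset/ndF/leq_maxr.
  by move=> [n _ []/= ? ?]; split; exists n.
move=> k; have [? ?] := Foo k.
split; first exact: measurableX.
by rewrite /lebesgue2 product_measure1E// lte_mul_pinfty// ge0_fin_numE.
Qed.

(* Redeclared here because the library's sigma-finite instance on [_ \x _] is
   not found by unification when the factors are not probabilities. *)
HB.instance Definition _ := Measure_isSigmaFinite.Build _ _ _ lebesgue2
  sigma_finite_lebesgue2.

Definition toC (x : R2) : C := x.1 +i* x.2.

Definition vdiv (x q : R2) : R2 :=
  let z := toC x / toC q in (complex.Re z, complex.Im z).

(* The library's norm [`|x|] on [R * R] is the sup norm, hence a separate
   Euclidean norm. *)
Definition enorm (x : R2) : R := normc (toC x).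

Definition dotp (p x : R2) : R := p.1 * x.1 + p.2 * x.2.

Definition expi (t : R) : C := cos t +i* sin t.

Definition R2star : set R2 := [set x | x != (0, 0)].

(* Vectors of L^2(R2star) are represented by functions on the whole plane; only
   their values on [R2star], up to null sets, matter. *)
Definition L2 (f : R2 -> C) : Prop :=
  cmeasurable_fun R2star f /\
  (\int[lebesgue2]_(x in R2star) ((normc (f x)) ^+ 2)%:E < +oo)%E.

Definition braket (f g : R2 -> C) : C :=
  cintegral lebesgue2 R2star (fun x => (f x)^* * g x).

Definition L2norm (f : R2 -> C) : R :=
  Num.sqrt (Rintegral lebesgue2 R2star (fun x => normc (f x) ^+ 2)).

Definition admissible (f : R2 -> C) : Prop :=
  (\int[lebesgue2]_(x in R2star)
     ((normc (f x)) ^+ 2 / (enorm x) ^+ 2)%:E < +oo)%E.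

Fixpoint Ck (k : nat) (f : R2 -> R) : Prop :=
  match k with
  | 0 => continuous f
  | k'.+1 =>
      [/\ forall x, derivable f x (1, 0) /\ derivable f x (0, 1),
          Ck k' (fun x => 'D_(1, 0) f x) & Ck k' (fun x => 'D_(0, 1) f x)]
  end.

(* A test function on [R2star] is identified with its extension by 0 to the
   plane, which is smooth because the support is a compact set avoiding 0. *)
Definition test_function (f : R2 -> C) : Prop :=
  [/\ forall k, Ck k (fun x => complex.Re (f x)),
      forall k, Ck k (fun x => complex.Im (f x)),
      compact (closure [set x | f x != 0])
    & closure [set x | f x != 0] `<=` R2star].

Definition U (q p : R2) (f : R2 -> C) : R2 -> C :=
  fun x => expi (dotp p x) / (enorm q)%:C * f (vdiv x q).

(* Inverse of the Duflo-Moore operator, which is multiplication by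
   2 pi / |x|. *)
Definition CDM_inv (f : R2 -> C) : R2 -> C :=
  fun x => (enorm x / (2 * pi))%:C * f x.

Definition ketbra (f g : R2 -> C) : (R2 -> C) -> (R2 -> C) :=
  fun h x => braket g h * f x.

Definition Gamma : set (R2 * R2) := R2star `*` setT.

Definition lebesgueGamma := (lebesgue2 \x lebesgue2)%E.

HB.instance Definition _ := Measure.on lebesgueGamma.

(* [operator_of w M]: M is the weak integral over [Gamma] of
   C^-1 U(q,p) C^-1 w(q,p), as a sesquilinear form on test functions. *)
Definition operator_of (w : R2 -> R2 -> C) (M : (R2 -> C) -> (R2 -> C)) : Prop :=
  forall f g : R2 -> C, test_function f -> test_function g ->
  let F := fun qp : R2 * R2 =>
    braket f (CDM_inv (U qp.1 qp.2 (CDM_inv g))) * w qp.1 qp.2 in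
  cintegrable lebesgueGamma Gamma F /\
  cintegral lebesgueGamma Gamma F = braket f (M g).

Definition orthonormal_basis (e : nat -> R2 -> C) : Prop :=
  [/\ forall n, L2 (e n),
      forall m n, braket (e m) (e n) = (m == n)%:R
    & forall (f : R2 -> C) (eps : R), L2 f -> 0 < eps ->
      exists (n : nat) (c : nat -> C),
        L2norm (fun x => f x - \sum_(i < n) c i * e i x) < eps].

(* [t] is the trace of [A]: the diagonal series converges to [t] in every
   orthonormal basis.  The space is separable and infinite-dimensional, so
   bases are sequences; quantifying over all of them includes all
   rearrangements, so the convergence is unconditional. *)
Definition is_trace (A : (R2 -> C) -> (R2 -> C)) (t : C) : Prop :=
  forall e : nat -> R2 -> C, orthonormal_basis e ->
  (fun n => complex.Re (\sum_(i < n) braket (e i) (A (e i))))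
    @ \oo --> complex.Re t /\
  (fun n => complex.Im (\sum_(i < n) braket (e i) (A (e i))))
    @ \oo --> complex.Im t.

(* [function_of M w]: w(q,p) is 1/q times the conjugate of Tr(U(q,p) M). *)
Definition function_of (M : (R2 -> C) -> (R2 -> C)) (w : R2 -> R2 -> C) : Prop :=
  forall q p : R2, R2star q ->
  exists2 t : C, is_trace (U q p \o M) t & w q p = (enorm q)^-1%:C * t^*.

Definition varpi (psi : R2 -> C) (q p : R2) : C :=
  braket (U q p psi) psi / (enorm q)%:C.

End Plane.

(* Main.v *)
(** Write [psi0] for [psi] extended by 0 at the origin.  The matrix element of
    C^-1 U(q,p) C^-1 between test functions [f], [g] is the Fourier transform at
    [p] of [A_q(x) = conj f(x) |x|^2 g(x/q)] up to the factor
    [1 / (4 pi^2 |q|^2)], and [varpi] is the conjugate of the Fourier transform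
    of [B_q(x) = conj psi0(x) psi0(x/q)] up to the factor [1 / |q|^2].  For
    almost every [q] the integral over [p] is therefore computed by Parseval's
    formula, and the change of variables [y = x/q], whose Jacobian is
    [|x|^2 / |y|^4], turns the remaining double integral over [(q, x)] into
    <f|psi> <psi|g>.

    Absolute convergence uses no smoothness of [f] and [g]: by AM-GM and Bessel's
    inequality, [|q|^-4 |FT A_q| |FT B_q|] is dominated by
    [|q|^-6 ||A_q||^2 + |q|^-2 ||B_q||^2], and the same change of variables
    bounds the integral of the second term by ||psi||^2 times the admissibility
    integral.  Bessel's inequality and Parseval's formula follow by Abel
    summation: the Fourier transform of [exp (- e |t|)] is the Poisson kernel.

    Conversely U(q,p)|psi><psi| has trace <psi|U(q,p) psi> by Parseval's identity
    for orthonormal bases. *)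
Require Import Defs.
From HB Require Import structures.
From mathcomp Require Import all_boot all_order all_algebra.
From mathcomp Require Import all_classical all_reals all_analysis.
From mathcomp Require Import measurable_realfun.
From mathcomp Require Import complex ring lra.

Set Implicit Arguments.
Unset Strict Implicit.
Unset Printing Implicit Defensive.

Import Order.TTheory GRing.Theory Num.Theory.
Import numFieldNormedType.Exports.
Import Normc.

Local Open Scope classical_set_scope.
Local Open Scope ring_scope.
Local Open Scope complex_scope.

Local Notation "z ^*" := (Num.conj z) : complex_scope.

(** * Complex-valued integrals *)

(** The function [psi] need be neither continuous nor bounded, and for an individual [q] the product
    B_q is known to be integrable but not square-integrable. Plancherel's theorem in L^2 is
    therefore avoided: [bessel] starts from an integrable function and allows an infinite right-hand
    side, and [parseval] puts continuity and boundedness on the factor A_q alone. Its remaining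
    assumption, integrability of the product of the two transforms, comes from integrability over
    (q, p) by Fubini, hence for almost every [q].

    The weight |q|^-4 is split as |q|^-3 |q|^-1 because the change of variables turns |q|^-2 into
    (|x|^2 / |y|^4) (|y|^2 / |x|^2) = |y|^-2, exactly the admissibility weight. The compactly
    supported factors absorb |q|^-6, which together with the |x|^4 of |A_q|^2 becomes |y|^2.

    All integrals live on the whole plane. Since the inverse of 0 is 0, x/0 is the origin and
    [varpi] vanishes at q = 0; as psi0, f and g vanish at the origin, degenerate points contribute
    zeros instead of sets to excise. *)

Section ComplexModulus.
Variable R : realType.
Implicit Types z w : R[i].

Lemma eqc z w : complex.Re z = complex.Re w -> complex.Im z = complex.Im w ->
  z = w.
Proof. by case: z w => a b [c e] /= -> ->. Qed.

Lemma normc_ge0 z : 0 <= normc z.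
Proof. by case: z => a b; rewrite /normc sqrtr_ge0. Qed.

Lemma sqr_normc_ReIm z : normc z ^+ 2 = complex.Re z ^+ 2 + complex.Im z ^+ 2.
Proof. by case: z => a b; rewrite /= sqr_sqrtr// addr_ge0// sqr_ge0. Qed.

Lemma normr_Re_le z : `|complex.Re z| <= normc z.
Proof.
rewrite -(@ler_pXn2r _ 2)// ?nnegrE ?normc_ge0// sqr_normc_ReIm real_normK ?num_real//.
by rewrite lerDl sqr_ge0.
Qed.

Lemma normr_Im_le z : `|complex.Im z| <= normc z.
Proof.
rewrite -(@ler_pXn2r _ 2)// ?nnegrE ?normc_ge0// sqr_normc_ReIm real_normK ?num_real//.
by rewrite lerDr sqr_ge0.
Qed.

Lemma normc_le_ReIm z : normc z <= `|complex.Re z| + `|complex.Im z|.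
Proof.
rewrite -(@ler_pXn2r _ 2)// ?nnegrE ?normc_ge0// ?addr_ge0// sqr_normc_ReIm.
rewrite sqrrD !real_normK ?num_real// lerD2r lerDl.
by rewrite mulrn_wge0// mulr_ge0.
Qed.

Lemma normc_conj z : normc z^* = normc z.
Proof. by case: z => a b; rewrite /normc /= sqrrN. Qed.

Lemma normc_real (r : R) : normc r%:C = `|r|.
Proof. by rewrite /= expr0n addr0 sqrtr_sqr. Qed.

Lemma conj_mulc z : z^* * z = (normc z ^+ 2)%:C.
Proof.
rewrite sqr_normc_ReIm; case: z => a b.
by apply: eqc; rewrite /= ?cReM ?cImM /=; ring.
Qed.

Lemma cReM z w : complex.Re (z * w) =
  complex.Re z * complex.Re w - complex.Im z * complex.Im w.
Proof. by case: z w => a b [c e]. Qed.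

Lemma cImM z w : complex.Im (z * w) =
  complex.Re z * complex.Im w + complex.Im z * complex.Re w.
Proof. by case: z w => a b [c e]. Qed.

Lemma cReD z w : complex.Re (z + w) = complex.Re z + complex.Re w.
Proof. by case: z w => a b [c e]. Qed.

Lemma cImD z w : complex.Im (z + w) = complex.Im z + complex.Im w.
Proof. by case: z w => a b [c e]. Qed.

Lemma cRe_conj z : complex.Re z^* = complex.Re z. Proof. by case: z. Qed.

Lemma cIm_conj z : complex.Im z^* = - complex.Im z. Proof. by case: z. Qed.

Lemma conjcM z w : (z * w)^* = z^* * w^*.
Proof. exact: rmorphM. Qed.

Lemma conjc_realc (r : R) : (r%:C)^* = r%:C.
Proof. exact: conjc_real. Qed.

Lemma realcM (r s : R) : (r * s)%:C = r%:C * s%:C.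
Proof. exact: (rmorphM (real_complex R)). Qed.

End ComplexModulus.

(** Turns integrals over a domain into integrals over the whole type, the only ones for which Fubini
    and the changes of variables are stated. *)
Definition zero_ext {R : realType} {T : Type} (D : set T) (f : T -> R[i]) :
  T -> R[i] := fun x => if x \in D then f x else 0.

Section ComplexIntegration.
Context {R : realType} {d : measure_display} {T : measurableType d}.
Variable mu : {measure set T -> \bar R}.
Variables (D : set T) (mD : measurable D).
Implicit Types f g : T -> R[i].

Lemma eq_cmeasurable f g : {in D, f =1 g} ->
  cmeasurable_fun D f -> cmeasurable_fun D g.
Proof.
move=> fg [fr fi]; split; [move: fr|move: fi]; apply: eq_measurable_fun;
  by move=> x xD; rewrite fg.
Qed.

Lemma cmeasurable_cst (c : R[i]) : cmeasurable_fun D (fun=> c).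
Proof. by split; exact: measurable_cst. Qed.

Lemma cmeasurable_real (h : T -> R) : measurable_fun D h ->
  cmeasurable_fun D (fun x => (h x)%:C).
Proof. by move=> mh; split => //; exact: measurable_cst. Qed.

Lemma cmeasurableD f g : cmeasurable_fun D f -> cmeasurable_fun D g ->
  cmeasurable_fun D (fun x => f x + g x).
Proof.
move=> [fr fi] [gr gi]; split.
- under eq_fun do rewrite cReD; exact: measurable_funD.
- under eq_fun do rewrite cImD; exact: measurable_funD.
Qed.

Lemma cmeasurableM f g : cmeasurable_fun D f -> cmeasurable_fun D g ->
  cmeasurable_fun D (fun x => f x * g x).
Proof.
move=> [fr fi] [gr gi]; split.
- under eq_fun do rewrite cReM.
  by apply: measurable_funB; apply: measurable_funM.
- under eq_fun do rewrite cImM.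
  by apply: measurable_funD; apply: measurable_funM.
Qed.

Lemma cmeasurable_conj f : cmeasurable_fun D f ->
  cmeasurable_fun D (fun x => (f x)^*).
Proof.
move=> [fr fi]; split.
- by under eq_fun do rewrite cRe_conj.
- under eq_fun do rewrite cIm_conj; exact: measurable_funN.
Qed.

Lemma measurable_normc f : cmeasurable_fun D f ->
  measurable_fun D (fun x => normc (f x)).
Proof.
move=> [fr fi].
rewrite [X in measurable_fun _ X](_ : _ = fun x =>
    Num.sqrt (complex.Re (f x) ^+ 2 + complex.Im (f x) ^+ 2)); last first.
  by apply/funext => x; case: (f x).
apply: (measurable_comp (F := setT)) => //.
  by apply: continuous_measurable_fun; exact: sqrt_continuous.
by apply: measurable_funD; apply: measurable_funX.
Qed.

(** The modulus lies above |Re| and |Im| and below their sum; domination arguments can thus be run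
    on a single real function. *)
Lemma cintegrableP f : cintegrable mu D f <->
  cmeasurable_fun D f /\ mu.-integrable D (fun x => (normc (f x))%:E).
Proof.
split=> [[fr fi]|[mf nf]].
  have mf : cmeasurable_fun D f.
    by split; apply/measurable_EFinP; [move: fr|move: fi] => /measurable_int.
  split => //.
  apply: (le_integrable mD (g := fun x => (`|complex.Re (f x)| + `|complex.Im (f x)|)%:E)).
  - by apply/measurable_EFinP; exact: measurable_normc.
  - move=> x _; rewrite /= lee_fin ger0_norm ?normc_ge0// ger0_norm ?addr_ge0//.
    exact: normc_le_ReIm.
  - rewrite (_ : (fun x => _) = ((fun x => `|complex.Re (f x)|%:E) \+
       (fun x => `|complex.Im (f x)|%:E))%E)//.
    by apply: integrableD => //; exact: integrable_norm.
case: (mf) => fr fi; split.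
- apply: (le_integrable mD _ _ nf); first exact/measurable_EFinP.
  by move=> x _; rewrite /= lee_fin (ger0_norm (normc_ge0 _)) normr_Re_le.
- apply: (le_integrable mD _ _ nf); first exact/measurable_EFinP.
  by move=> x _; rewrite /= lee_fin (ger0_norm (normc_ge0 _)) normr_Im_le.
Qed.

Lemma cintegrable_measurable f : cintegrable mu D f -> cmeasurable_fun D f.
Proof. by move=> /cintegrableP[]. Qed.

Lemma cintegrable_lty f : cmeasurable_fun D f ->
  (\int[mu]_(x in D) (normc (f x))%:E < +oo)%E -> cintegrable mu D f.
Proof.
move=> mf foo; apply/cintegrableP; split => //; apply/integrableP; split.
  by apply/measurable_EFinP; exact: measurable_normc.
under eq_integral => x _ do rewrite /= ger0_norm ?normc_ge0//.
exact: foo.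
Qed.

Lemma cintegrable_normc_lty f : cintegrable mu D f ->
  (\int[mu]_(x in D) (normc (f x))%:E < +oo)%E.
Proof. by move=> /cintegrableP[_ /integrable_lty]; apply. Qed.

Lemma le_cintegrable f (g : T -> R) : cmeasurable_fun D f ->
  (forall x, D x -> normc (f x) <= g x) ->
  mu.-integrable D (fun x => (g x)%:E) -> cintegrable mu D f.
Proof.
move=> mf fg ig; apply/cintegrableP; split => //.
apply: (le_integrable mD _ _ ig).
  by apply/measurable_EFinP; exact: measurable_normc.
move=> x Dx; rewrite /= lee_fin ger0_norm ?normc_ge0//.
by rewrite (le_trans (fg _ Dx))// ler_norm.
Qed.

Lemma eq_cintegral f g : {in D, f =1 g} -> cintegral mu D f = cintegral mu D g.
Proof.
by move=> fg; rewrite /cintegral; congr (_ +i* _);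
  apply: eq_Rintegral => x xD; rewrite fg.
Qed.

Lemma eq_cintegrable f g : {in D, f =1 g} ->
  cintegrable mu D f -> cintegrable mu D g.
Proof.
move=> fg [fr fi]; split; [move: fr|move: fi]; apply: eq_integrable => //;
  by move=> x xD; rewrite fg.
Qed.

Lemma cintegrableZ f (c : R[i]) : cintegrable mu D f ->
  cintegrable mu D (fun x => c * f x).
Proof.
move=> [fr fi]; split.
- under eq_fun do rewrite cReM EFinB !EFinM.
  by apply: integrableB => //; exact: integrableZl.
- under eq_fun do rewrite cImM EFinD !EFinM.
  by apply: integrableD => //; exact: integrableZl.
Qed.

Lemma cintegrable_conj f : cintegrable mu D f ->
  cintegrable mu D (fun x => (f x)^*).
Proof.
move=> [fr fi]; split.
- by under eq_fun do rewrite cRe_conj.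
- rewrite (_ : (fun x => _) = -%E \o (fun x => (complex.Im (f x))%:E)).
    exact: integrableN.
  by apply/funext => x; rewrite /= cIm_conj EFinN.
Qed.

Lemma cintegrable_boundM f (g : T -> R[i]) (M : R) :
  cintegrable mu D f -> cmeasurable_fun D g ->
  (forall x, D x -> normc (g x) <= M) -> cintegrable mu D (fun x => g x * f x).
Proof.
move=> fi mg gM; have [mf nf] := (cintegrableP f).1 fi.
apply: (@le_cintegrable _ (fun x => M * normc (f x))).
- exact: cmeasurableM.
- by move=> x Dx; rewrite normcM ler_wpM2r ?normc_ge0// gM.
- by under eq_fun do rewrite EFinM; exact: integrableZl.
Qed.

(** Pointwise |f g| <= |f|^2 + |g|^2, which is all that Cauchy-Schwarz would be used for here. *)
Lemma cintegrable_mul f g : cmeasurable_fun D f -> cmeasurable_fun D g ->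
  (\int[mu]_(x in D) (normc (f x) ^+ 2)%:E < +oo)%E ->
  (\int[mu]_(x in D) (normc (g x) ^+ 2)%:E < +oo)%E ->
  cintegrable mu D (fun x => f x * g x).
Proof.
move=> mf mg foo goo; apply: cintegrable_lty => //; first exact: cmeasurableM.
have mnf : measurable_fun D (fun x => normc (f x) ^+ 2).
  by apply: measurable_funX; exact: measurable_normc.
have mng : measurable_fun D (fun x => normc (g x) ^+ 2).
  by apply: measurable_funX; exact: measurable_normc.
apply: (@le_lt_trans _ _ (\int[mu]_(x in D) ((normc (f x) ^+ 2)%:E + (normc (g x) ^+ 2)%:E))%E).
  apply: ge0_le_integral => //.
  - by move=> x _; rewrite lee_fin normc_ge0.
  - by apply/measurable_EFinP; apply: measurable_normc; exact: cmeasurableM.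
  - by apply: emeasurable_funD; exact/measurable_EFinP.
  - move=> x _; rewrite -EFinD lee_fin normcM.
    have := sqr_ge0 (normc (f x) - normc (g x)).
    have := mulr_ge0 (normc_ge0 (f x)) (normc_ge0 (g x)).
    by rewrite sqrrB => h1 h2; lra.
rewrite ge0_integralD//.
- by apply: lte_add_pinfty.
- by move=> x _; rewrite lee_fin sqr_ge0.
- exact/measurable_EFinP.
- by move=> x _; rewrite lee_fin sqr_ge0.
- exact/measurable_EFinP.
Qed.

Lemma cintegralD f g : cintegrable mu D f -> cintegrable mu D g ->
  cintegral mu D (fun x => f x + g x) = cintegral mu D f + cintegral mu D g.
Proof.
move=> [fr fi] [gr gi]; apply: eqc; rewrite ?cReD ?cImD /= -RintegralD//;
 by apply: eq_Rintegral => x _; rewrite ?cReD ?cImD.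
Qed.

Lemma cintegralZ f (c : R[i]) : cintegrable mu D f ->
  cintegral mu D (fun x => c * f x) = c * cintegral mu D f.
Proof.
move=> [fr fi].
have iZ a (h : T -> R) : mu.-integrable D (EFin \o h) ->
    mu.-integrable D (EFin \o (fun x => a * h x)).
  by move=> ih; exact: (integrableZl mD a ih).
apply: eqc; rewrite ?cReM ?cImM /= -!RintegralZl//.
- rewrite -RintegralB//; [|exact: iZ|exact: iZ].
  by apply: eq_Rintegral => x _; rewrite cReM.
- rewrite -RintegralD//; [|exact: iZ|exact: iZ].
  by apply: eq_Rintegral => x _; rewrite cImM.
Qed.

Lemma cintegral_conj f : cintegrable mu D f ->
  cintegral mu D (fun x => (f x)^*) = (cintegral mu D f)^*.
Proof.
move=> [fr fi]; apply: eqc; rewrite ?cRe_conj ?cIm_conj /=.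
  by apply: eq_Rintegral => x _; rewrite cRe_conj.
rewrite -[RHS]mulN1r -RintegralZl//.
by apply: eq_Rintegral => x _; rewrite cIm_conj mulN1r.
Qed.

Lemma cintegral_mkcond f : cintegral mu D f = cintegral mu setT (zero_ext D f).
Proof.
rewrite /cintegral; congr (_ +i* _); rewrite Rintegral_mkcond;
  by apply: eq_Rintegral => x _; rewrite patchE /zero_ext; case: ifP.
Qed.

Lemma cmeasurable_zero_ext f :
  cmeasurable_fun D f -> cmeasurable_fun setT (zero_ext D f).
Proof.
move=> [fr fi]; split.
- rewrite [X in measurable_fun _ X](_ : _ = (fun x => complex.Re (f x)) \_ D).
    by apply/(measurable_restrictT _ _).1.
  by apply/funext => x; rewrite patchE /zero_ext; case: ifP.
- rewrite [X in measurable_fun _ X](_ : _ = (fun x => complex.Im (f x)) \_ D).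
    by apply/(measurable_restrictT _ _).1.
  by apply/funext => x; rewrite patchE /zero_ext; case: ifP.
Qed.

Lemma cintegrable_mkcond f :
  cintegrable mu setT (zero_ext D f) -> cintegrable mu D f.
Proof.
move=> [fr fi]; split; apply/(integrable_mkcond _ mD); [move: fr|move: fi];
  apply: eq_integrable => // x _; by rewrite patchE /zero_ext; case: ifP.
Qed.

Lemma cintegral_real (h : T -> R) :
  cintegral mu D (fun x => (h x)%:C) = (Rintegral mu D h)%:C.
Proof.
apply: eqc => //=; rewrite /Rintegral integral0_eq//.
Qed.

(** Either the right-hand side is infinite, or it is finite and [f] is integrable. *)
Lemma Re_cintegral_le f : cmeasurable_fun D f ->
  ((complex.Re (cintegral mu D f))%:E <= \int[mu]_(x in D) (normc (f x))%:E)%E.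
Proof.
move=> mf; have [foo|] := ltP (\int[mu]_(x in D) (normc (f x))%:E)%E +oo%E.
  have fi := cintegrable_lty mf foo; have [fr _] := fi.
  have [_ nf] := (cintegrableP f).1 fi.
  rewrite /= /Rintegral fineK; last exact: integrable_fin_num.
  apply: le_integral => // x _; rewrite lee_fin.
  by rewrite (le_trans (ler_norm _))// normr_Re_le.
by rewrite leye_eq => /eqP ->; rewrite leey.
Qed.

(** The factor 2 is the price of bounding real and imaginary parts separately; it only enters
    domination constants. *)
Lemma normc_cintegral_le f : cintegrable mu D f ->
  normc (cintegral mu D f) <= 2 * Rintegral mu D (fun x => normc (f x)).
Proof.
move=> fi; have [mf nf] := (cintegrableP f).1 fi.
case: (fi) => fr fim.
rewrite mulr2n mulrDl mul1r (le_trans (normc_le_ReIm _))//=.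
apply: lerD; apply: (le_trans (le_normr_Rintegral _ _)) => //;
  apply: le_Rintegral => //.
- exact: integrable_norm.
- by move=> x _; exact: normr_Re_le.
- exact: integrable_norm.
- by move=> x _; exact: normr_Im_le.
Qed.

End ComplexIntegration.

Lemma ae_eq_cintegral {R : realType} {d : measure_display}
    {T : measurableType d} (mu : {measure set T -> \bar R}) (f g : T -> R[i]) :
  cmeasurable_fun setT f -> cmeasurable_fun setT g ->
  {ae mu, forall x, f x = g x} -> cintegral mu setT f = cintegral mu setT g.
Proof.
move=> [fr fi] [gr gi] fg; apply: eqc => /=; rewrite /Rintegral;
  congr fine; apply: ae_eq_integral => //; try exact/measurable_EFinP;
  by apply: filterS fg => x /= -> _.
Qed.

(** Componentwise, the form in which [is_trace] states convergence. *)
Definition ccvg {R : realType} (u : nat -> R[i]) (l : R[i]) : Prop :=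
  (complex.Re (u n) @[n --> \oo] --> complex.Re l) /\
  (complex.Im (u n) @[n --> \oo] --> complex.Im l).

Section ComplexConvergence.
Context {R : realType}.
Implicit Types (u v : nat -> R[i]) (l k : R[i]).

Lemma ccvg_unique u l k : ccvg u l -> ccvg u k -> l = k.
Proof.
move=> [rl il] [rk ik]; apply: eqc.
- exact: cvg_unique rl rk.
- exact: cvg_unique il ik.
Qed.

Lemma ccvg_cst l : ccvg (fun=> l) l.
Proof. by split; exact: cvg_cst. Qed.

Lemma ccvgM u v l k : ccvg u l -> ccvg v k -> ccvg (fun n => u n * v n) (l * k).
Proof.
move=> [rl il] [rk ik]; split; rewrite ?cReM ?cImM.
- under eq_fun do rewrite cReM.
  by apply: cvgB; apply: cvgM.
- under eq_fun do rewrite cImM.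
  by apply: cvgD; apply: cvgM.
Qed.

Lemma ccvg_real (r : nat -> R) (s : R) :
  r n @[n --> \oo] --> s -> ccvg (fun n => (r n)%:C) s%:C.
Proof. by move=> rs; split => //=; exact: cvg_cst. Qed.

Lemma dominated_ccvg {d : measure_display} {T : measurableType d}
    (mu : {measure set T -> \bar R}) (f_ : nat -> T -> R[i]) (f : T -> R[i])
    (g : T -> R) :
  (forall n, cmeasurable_fun setT (f_ n)) ->
  (forall x, ccvg (f_ ^~ x) (f x)) ->
  mu.-integrable setT (fun x => (g x)%:E) ->
  (forall n x, normc (f_ n x) <= g x) ->
  ccvg (fun n => cintegral mu setT (f_ n)) (cintegral mu setT f).
Proof.
move=> mf_ f_f ig f_g.
have fin_f : cintegrable mu setT f.
  apply: (@le_cintegrable _ _ _ _ _ measurableT _ g) => //.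
    split.
      apply: (@measurable_fun_cvg _ _ _ _ (fun n x => complex.Re (f_ n x))) => //.
        by move=> n; have [] := mf_ n.
      by move=> x _; have [] := f_f x.
    apply: (@measurable_fun_cvg _ _ _ _ (fun n x => complex.Im (f_ n x))) => //.
      by move=> n; have [] := mf_ n.
    by move=> x _; have [] := f_f x.
  move=> x _.
  (* The bound by [g] passes to the limit because the modulus is a continuous function of the two
     components. *)
  have cn : normc (f_ n x) @[n --> \oo] --> normc (f x).
    have [cr ci] := f_f x.
    have E z : normc z = Num.sqrt (complex.Re z ^+ 2 + complex.Im z ^+ 2) :> R.
      by case: z.
    rewrite E; under eq_fun do rewrite E.
    apply: continuous_cvg; first exact: sqrt_continuous.
    by apply: cvgD; rewrite expr2; under eq_fun do rewrite expr2; apply: cvgM.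
  apply: (cvgr_to_le cn); exact: nearW.
have [ifr ifi] := fin_f.
split; rewrite /= /Rintegral; apply: fine_cvg.
- rewrite fineK; last exact: integrable_fin_num.
  apply: (@dominated_cvg _ _ _ mu setT measurableT _ _ (fun x => (g x)%:E)) => //.
  + by move=> n; apply/measurable_EFinP; have [] := mf_ n.
  + by move=> x _; apply: cvg_EFin; [exact: nearW|have [] := f_f x].
  + by move=> n x _; rewrite lee_fin (le_trans (normr_Re_le _)).
- rewrite fineK; last exact: integrable_fin_num.
  apply: (@dominated_cvg _ _ _ mu setT measurableT _ _ (fun x => (g x)%:E)) => //.
  + by move=> n; apply/measurable_EFinP; have [] := mf_ n.
  + by move=> x _; apply: cvg_EFin; [exact: nearW|have [] := f_f x].
  + by move=> n x _; rewrite lee_fin (le_trans (normr_Im_le _)).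
Qed.

End ComplexConvergence.

(** * Fubini's theorem for complex integrands *)

Section ComplexFubini.
Context {R : realType} {d1 d2 : measure_display}.
Context {T1 : measurableType d1} {T2 : measurableType d2}.
Variable m1 : {sigma_finite_measure set T1 -> \bar R}.
Variable m2 : {sigma_finite_measure set T2 -> \bar R}.
Implicit Type f : T1 * T2 -> R[i].

(** Tonelli applied to the positive and the negative part; Fourier transforms thereby become
    measurable in their parameters before any integrability is known. *)
Lemma emeasurable_fubini_F (h : T1 * T2 -> \bar R) : measurable_fun setT h ->
  measurable_fun setT (fubini_F m2 h).
Proof.
move=> mh; rewrite (_ : fubini_F m2 h = fun x =>
    (\int[m2]_y h^\+ (x, y) - \int[m2]_y h^\- (x, y))%E).
  apply: emeasurable_funB.
  - by apply: (measurable_fun_fubini_tonelli_F (h^\+)%E) => //;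
      exact: measurable_funepos.
  - by apply: (measurable_fun_fubini_tonelli_F (h^\-)%E) => //;
      exact: measurable_funeneg.
apply/funext=> x; rewrite [LHS]integralE.
under eq_integral do rewrite funepos_comp/=.
by under [X in (_ - X)%E = _]eq_integral do rewrite funeneg_comp/=.
Qed.

Lemma measurable_Rintegral_prod (h : T1 * T2 -> R) : measurable_fun setT h ->
  measurable_fun setT (fun x => Rintegral m2 setT (fun y => h (x, y))).
Proof.
move=> mh; apply: (measurableT_comp (f := fine)); first exact: fine_measurable.
by apply: (@emeasurable_fubini_F (EFin \o h)); exact/measurable_EFinP.
Qed.

Lemma cmeasurable_cintegral f : cmeasurable_fun setT f ->
  cmeasurable_fun setT (fun x => cintegral m2 setT (fun y => f (x, y))).
Proof. by move=> [fr fi]; split; [exact: (measurable_Rintegral_prod fr)|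
  exact: (measurable_Rintegral_prod fi)]. Qed.

Lemma cintegrable_prod f : cmeasurable_fun setT f ->
  (\int[m1]_x \int[m2]_y (normc (f (x, y)))%:E < +oo)%E ->
  cintegrable (m1 \x m2)%E setT f.
Proof.
move=> mf foo; apply: cintegrable_lty => //.
rewrite (fubini_tonelli1 (fun z => (normc (f z))%:E))//.
- by apply/measurable_EFinP; exact: measurable_normc.
- by move=> x; rewrite lee_fin normc_ge0.
Qed.

(** [Rintegral] replaces an infinite inner integral by 0, so the two iterated integrands differ at
    most on the null set of non-integrable slices. *)
Let Rintegral12 (h : T1 * T2 -> R) :
  (m1 \x m2)%E.-integrable setT (EFin \o h) ->
  Rintegral m1 setT (fun x => Rintegral m2 setT (fun y => h (x, y))) =
  Rintegral (m1 \x m2)%E setT h.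
Proof.
move=> ih; have mh : measurable_fun setT h.
  by apply/measurable_EFinP; exact: measurable_int ih.
rewrite [RHS]/Rintegral -(integral12_prod_meas1 ih) [LHS]/Rintegral.
congr fine; apply: ae_eq_integral => //.
- by apply/measurable_EFinP; exact: measurable_Rintegral_prod.
- exact: measurable_fubini_F ih.
have := integrable_ae measurableT (integrable_fubini_F ih).
by apply: filterS => x /(_ I) h1 _; rewrite /Rintegral fineK.
Qed.

Lemma cintegral12 f : cintegrable (m1 \x m2)%E setT f ->
  cintegral m1 setT (fun x => cintegral m2 setT (fun y => f (x, y))) =
  cintegral (m1 \x m2)%E setT f.
Proof. by move=> [fr fi]; apply: eqc; [exact: Rintegral12 fr|exact: Rintegral12 fi]. Qed.

End ComplexFubini.

Section ComplexFubiniSwap.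
Context {R : realType} {d1 d2 : measure_display}.
Context {T1 : measurableType d1} {T2 : measurableType d2}.
Variable m1 : {sigma_finite_measure set T1 -> \bar R}.
Variable m2 : {sigma_finite_measure set T2 -> \bar R}.
Implicit Type f : T1 * T2 -> R[i].

Lemma cmeasurable_comp {d d' : measure_display} {S : measurableType d}
    {S' : measurableType d'} (f : S -> R[i]) (g : S' -> S) :
  cmeasurable_fun setT f -> measurable_fun setT g ->
  cmeasurable_fun setT (fun x => f (g x)).
Proof.
move=> [fr fi] mg; split; [exact: (measurableT_comp fr)|exact: (measurableT_comp fi)].
Qed.

Lemma cintegral_swap f : cintegrable (m1 \x m2)%E setT f ->
  cintegral m1 setT (fun x => cintegral m2 setT (fun y => f (x, y))) =
  cintegral m2 setT (fun y => cintegral m1 setT (fun x => f (x, y))).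
Proof.
move=> fi; have mf := cintegrable_measurable measurableT fi.
rewrite cintegral12//.
(* Tonelli for the modulus transfers integrability to the product taken in the other order. *)
have fi' : cintegrable (m2 \x m1)%E setT (fun z => f (z.2, z.1)).
  apply: cintegrable_prod.
    apply: (cmeasurable_comp (g := fun z : T2 * T1 => (z.2, z.1))) => //.
    exact: measurable_swap.
  rewrite -(fubini_tonelli (fun z => (normc (f z))%:E))/=; first last.
  - by move=> x; rewrite lee_fin normc_ge0.
  - by apply/measurable_EFinP; exact: measurable_normc.
  rewrite -(fubini_tonelli1 (fun z => (normc (f z))%:E))//.
  - by apply: cintegrable_normc_lty fi.
  - by apply/measurable_EFinP; exact: measurable_normc.
  - by move=> x; rewrite lee_fin normc_ge0.
rewrite (cintegral12 fi').
have [fr fim] := fi; have [fr' fim'] := fi'.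
by apply: eqc; rewrite /= /Rintegral -(integral21_prod_meas1 fr,
  integral21_prod_meas1 fim) -(integral12_prod_meas1 fr', integral12_prod_meas1 fim').
Qed.

(** In the applications the bounded kernel [E] is a phase, a Poisson kernel or 1; this justifies the
    exchanges of integrals in the proof of Parseval's formula. *)
Lemma cintegrable_tensor (E : T1 * T2 -> R[i]) (G : T1 -> R[i])
    (H : T2 -> R[i]) (M : R) :
  cmeasurable_fun setT E -> (forall z, normc (E z) <= M) ->
  cintegrable m1 setT G -> cintegrable m2 setT H ->
  cintegrable (m1 \x m2)%E setT (fun z => E z * (G z.1 * H z.2)).
Proof.
move=> mE EM Gi Hi.
have mG := cintegrable_measurable measurableT Gi.
have mH := cintegrable_measurable measurableT Hi.
have GHi : cintegrable (m1 \x m2)%E setT (fun z => G z.1 * H z.2).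
  apply: cintegrable_prod.
    by apply: cmeasurableM; apply: cmeasurable_comp.
  under eq_integral => x _.
    under eq_integral do rewrite /= normcM EFinM.
    rewrite ge0_integralZl//; first last.
    - by rewrite lee_fin normc_ge0.
    - by move=> y _; rewrite lee_fin normc_ge0.
    - by apply/measurable_EFinP; exact: measurable_normc.
    over.
  rewrite ge0_integralZr//; first last.
  - by apply: integral_ge0 => y _; rewrite lee_fin normc_ge0.
  - by move=> y _; rewrite lee_fin normc_ge0.
  - by apply/measurable_EFinP; exact: measurable_normc.
  apply: lte_mul_pinfty.
  - by apply: integral_ge0 => y _; rewrite lee_fin normc_ge0.
  - rewrite ge0_fin_numE; first exact: cintegrable_normc_lty.
    by apply: integral_ge0 => y _; rewrite lee_fin normc_ge0.
  - exact: cintegrable_normc_lty.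
by apply: (cintegrable_boundM measurableT GHi mE (M := M)).
Qed.

End ComplexFubiniSwap.

(* The set [Z] lets the change of variables ignore points where the map
   degenerates, provided that the integrand vanishes there. *)
Lemma cintegral_change_of_variables {R : realType} {d1 d2 : measure_display}
    {T1 : measurableType d1} {T2 : measurableType d2}
    (m1 : {measure set T1 -> \bar R}) (m2 : {measure set T2 -> \bar R})
    (phi : T1 -> T2) (w : T2 -> R) (Z : set T2) :
  (forall y, 0 <= w y) ->
  (forall h : T2 -> \bar R, measurable_fun setT h -> (forall y, 0 <= h y)%E ->
     (forall y, Z y -> h y = 0) ->
     \int[m1]_x h (phi x) = \int[m2]_y ((w y)%:E * h y))%E ->
  forall f : T2 -> R[i], cmeasurable_fun setT f -> (forall y, Z y -> f y = 0) ->
  cintegral m1 setT (fun x => f (phi x)) =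
  cintegral m2 setT (fun y => (w y)%:C * f y).
Proof.
move=> w0 cov f [fr fi] fZ.
suff cR (h : T2 -> R) : measurable_fun setT h -> (forall y, Z y -> h y = 0) ->
    Rintegral m1 setT (fun x => h (phi x)) =
    Rintegral m2 setT (fun y => w y * h y).
  apply: eqc => /=.
    rewrite (cR (fun y => complex.Re (f y)))// => [|y /fZ ->//].
    by apply: eq_Rintegral => y _; rewrite cReM /= mul0r subr0.
  rewrite (cR (fun y => complex.Im (f y)))// => [|y /fZ ->//].
  by apply: eq_Rintegral => y _; rewrite cImM /= mul0r addr0.
move=> mh hZ; rewrite /Rintegral; congr fine.
have mh' : measurable_fun setT (EFin \o h) by exact/measurable_EFinP.
have hZ' y : Z y -> (EFin \o h) y = 0%E by move=> /hZ /= ->.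
(* The hypothesis [cov] concerns nonnegative integrands. Positive and negative parts still vanish on
   [Z], and multiplication by w >= 0 commutes with taking either part. *)
rewrite [LHS]integralE [RHS]integralE; congr (_ - _)%E.
- under eq_integral do rewrite (funepos_comp (EFin \o h) phi)/=.
  rewrite cov; [|exact: measurable_funepos|by []|]; last first.
    by move=> y /hZ' hy; rewrite funeposE hy maxxx.
  by apply: eq_integral => y _; rewrite !funeposE /= EFinM maxe_pMr ?lee_fin// mule0.
- under eq_integral do rewrite (funeneg_comp (EFin \o h) phi)/=.
  rewrite cov; [|exact: measurable_funeneg|by []|]; last first.
    by move=> y /hZ' hy; rewrite funenegE hy oppe0 maxxx.
  apply: eq_integral => y _; rewrite !funenegE /= -mulrN EFinM.
  by rewrite maxe_pMr ?lee_fin// mule0.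
Qed.

(** * Changes of variables in the plane *)

Section LineChangeOfVariables.
Variable R : realType.
Notation mu := (@lebesgue_measure R).
Local Open Scope ereal_scope.

(** The image of Lebesgue measure under the map, scaled by |a|, has the right value on half-open
    intervals, and Lebesgue measure is the only measure that does. *)
Lemma ge0_integral_affine (a b : R) (h : R -> \bar R) : a != 0%R ->
  measurable_fun setT h -> (forall x, 0 <= h x) ->
  \int[mu]_x h x = `|a|%:E * \int[mu]_x h (a * x + b)%R.
Proof.
move=> a0 mh h0.
have mphi : measurable_fun [set: measurableTypeR R]
    ((fun x => (a * x + b)%R) : measurableTypeR R -> measurableTypeR R).
  by apply: measurable_funD => //; exact: mulrl_measurable.
pose phi : {mfun measurableTypeR R >-> measurableTypeR R} :=
  HB.pack ((fun x : R => (a * x + b)%R) : measurableTypeR R -> measurableTypeR R)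
   (isMeasurableFun.Build _ _ (measurableTypeR R) (measurableTypeR R) _ mphi).
pose r : {nonneg R} := NngNum (normr_ge0 a).
pose nu : {measure set (measurableTypeR R) -> \bar R} :=
  mscale r (pushforward mu phi).
transitivity (\int[nu mphi]_x h x); last first.
  rewrite ge0_integral_mscale//; congr (_ * _).
  rewrite ge0_integral_pushforward//.
apply: eq_measure_integral => A mA _.
apply: (@lebesgue_measure_unique _ (nu mphi)) => // _ [[c e] /= _ <-].
rewrite /nu /mscale /= /pushforward.
have [a1|a1] : (0 < a \/ a < 0)%R.
- by move: a0; rewrite neq_lt => /orP[|] ?; [right|left].
- rewrite (_ : _ @^-1` _ = `](c - b) / a, (e - b) / a]%classic)%R; last first.
    apply/seteqP; split => x /=; rewrite !in_itv/=.
      by rewrite ltr_pdivrMr// ler_pdivlMr// ltrBlDr lerBrDr (mulrC x).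
    by rewrite ltr_pdivrMr// ler_pdivlMr// ltrBlDr lerBrDr (mulrC x).
  rewrite !lebesgue_measure_itv/= !lte_fin ltr_pM2r ?invr_gt0// ltrD2r.
  rewrite gtr0_norm//; case: ifPn => _; last by rewrite mule0.
  by rewrite -!EFinB -EFinM -mulrBl mulrC divfK// opprB addrA subrK.
(* A negative slope exchanges the open and the closed endpoint; the length is not affected. *)
- rewrite (_ : _ @^-1` _ = `[(e - b) / a, (c - b) / a[%classic)%R; last first.
    apply/seteqP; split => x /=; rewrite !in_itv/=.
      by rewrite ltr_ndivlMr// ler_ndivrMr// ltrBlDr lerBrDr (mulrC x) andbC.
    by rewrite ltr_ndivlMr// ler_ndivrMr// ltrBlDr lerBrDr (mulrC x) andbC.
  rewrite !lebesgue_measure_itv/= !lte_fin ltr_nM2r ?invr_lt0// ltrD2r.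
  rewrite ltr0_norm//; case: ifPn => _; last by rewrite mule0.
  rewrite -!EFinB -EFinM -mulrBl; congr EFin; field.
  exact: ltr0_neq0.
Qed.

End LineChangeOfVariables.

Section PlaneChangeOfVariables.
Variable R : realType.
Local Notation R2 := (R * R)%type.
Local Notation mu2 := (@lebesgue2 R).
Implicit Types (h : R2 -> \bar R) (q x y : R2).

Definition vmul (q x : R2) : R2 :=
  (q.1 * x.1 - q.2 * x.2, q.2 * x.1 + q.1 * x.2).

Lemma toC_vmul q x : toC (vmul q x) = toC q * toC x.
Proof. by apply: eqc; rewrite /toC /= ?cReM ?cImM //= addrC. Qed.

Lemma toC_inj : injective (@toC R).
Proof. by case=> a b [c e] [-> ->]. Qed.

Lemma toC_vdiv x q : toC (vdiv x q) = toC x / toC q.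
Proof. by rewrite [LHS]/toC /vdiv; case: (toC x / toC q). Qed.

Lemma toC_eq0 x : (toC x == 0) = (x == (0, 0)).
Proof. by rewrite -(inj_eq toC_inj). Qed.

Lemma vdiv_vmul q x : q != (0, 0) -> vdiv (vmul q x) q = x.
Proof.
move=> q0; apply: toC_inj; rewrite toC_vdiv toC_vmul mulrAC divff ?mul1r//.
by rewrite toC_eq0.
Qed.

(** Because of this convention a function of x/q that vanishes at the origin vanishes on the whole
    slice q = 0. *)
Lemma vdivr0 x : vdiv x (0, 0) = (0, 0).
Proof. by apply: toC_inj; rewrite toC_vdiv (_ : toC (0, 0) = 0)// invr0 mulr0. Qed.

Lemma enorm_vdiv x q : enorm (vdiv x q) = enorm x / enorm q.
Proof. by rewrite /enorm toC_vdiv normcM normcV. Qed.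

Lemma enorm_vmul x q : enorm (vmul q x) = enorm q * enorm x.
Proof. by rewrite /enorm toC_vmul normcM. Qed.

Lemma enorm_ge0 x : 0 <= enorm x. Proof. exact: normc_ge0. Qed.

Lemma enorm0 : enorm (0, 0) = 0 :> R.
Proof. exact: normc0. Qed.

Lemma enorm_eq0 x : (enorm x == 0) = (x == (0, 0)).
Proof.
apply/idP/idP => [/eqP /eq0_normc /eqP|/eqP ->]; first by rewrite toC_eq0.
by rewrite enorm0.
Qed.

Lemma sqr_enorm x : enorm x ^+ 2 = x.1 ^+ 2 + x.2 ^+ 2.
Proof. by rewrite /enorm sqr_normc_ReIm. Qed.

Lemma vdivE x q : vdiv x q = ((x.1 * q.1 + x.2 * q.2) / enorm q ^+ 2,
  (x.2 * q.1 - x.1 * q.2) / enorm q ^+ 2).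
Proof.
rewrite sqr_enorm /vdiv; case: x q => [x1 x2] [q1 q2].
by rewrite /toC /=; congr (_, _); ring.
Qed.

Local Open Scope ereal_scope.

Lemma ge0_integral_plane12 h : measurable_fun setT h -> (forall x, 0 <= h x) ->
  \int[mu2]_x h x = \int[@lebesgue_measure R]_x \int[@lebesgue_measure R]_y h (x, y).
Proof. by move=> mh h0; exact: (@fubini_tonelli1 _ _ (measurableTypeR R)
  (measurableTypeR R) R (@lebesgue_measure R) (@lebesgue_measure R) h mh h0). Qed.

Lemma ge0_integral_plane21 h : measurable_fun setT h -> (forall x, 0 <= h x) ->
  \int[mu2]_x h x = \int[@lebesgue_measure R]_y \int[@lebesgue_measure R]_x h (x, y).
Proof. by move=> mh h0; exact: (@fubini_tonelli2 _ _ (measurableTypeR R)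
  (measurableTypeR R) R (@lebesgue_measure R) (@lebesgue_measure R) h mh h0). Qed.

(* Gaussian elimination reduces the planar change of variables to two
   one-dimensional ones. *)
Lemma ge0_integral_linear h (a b c e : R) : a != 0%R -> (a * e - b * c != 0)%R ->
  measurable_fun setT h -> (forall x, 0 <= h x) ->
  \int[mu2]_x h x = `|a * e - b * c|%:E *
    \int[mu2]_x h (a * x.1 + b * x.2, c * x.1 + e * x.2)%R.
Proof.
move=> a0 det0 mh h0.
have mlin (b1 b2 : R) : measurable_fun setT (fun x : R2 => (b1 * x.1 + b2 * x.2)%R).
  by apply: measurable_funD; apply: measurable_funM.
have mlin2 (a1 a2 b1 b2 : R) : measurable_fun setT (fun x : R2 =>
    h (a1 * x.1 + a2 * x.2, b1 * x.1 + b2 * x.2)%R).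
  by apply: (measurableT_comp mh); apply: measurable_fun_pair.
rewrite [in RHS]ge0_integral_plane21//.
(* The second pivot: the determinant is the product of [a] and [t]. *)
pose t := ((a * e - b * c) / a)%R.
have t0 : t != 0%R by rewrite mulf_neq0// invr_neq0.
(* Substituting u = a x + b y at fixed y gives c x + e y = (c / a) u + t y. *)
have E1 (y : R) : \int[@lebesgue_measure R]_x h (a * x + b * y, c * x + e * y)%R =
    `|a|^-1%:E * \int[@lebesgue_measure R]_x h (x, (c / a) * x + t * y)%R.
  rewrite [in RHS](@ge0_integral_affine _ a (b * y))//; last first.
    apply: (measurableT_comp mh); apply: measurable_fun_pair => //.
    by apply: measurable_funD => //; exact: mulrl_measurable.
  rewrite muleA -EFinM mulVf ?normr_eq0// mul1e.
  apply: eq_integral => x _; congr (h (_, _)).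
  by rewrite /t; field.
transitivity (`|a * e - b * c|%:E * \int[@lebesgue_measure R]_y (`|a|^-1%:E *
    \int[@lebesgue_measure R]_x h (x, (c / a) * x + t * y)%R)); last first.
  by congr (_ * _); apply: eq_integral => y _; rewrite -E1.
have mG : measurable_fun setT (fun x : R2 => h (x.1, (c / a) * x.1 + t * x.2)%R).
  by apply: (measurableT_comp mh); apply: measurable_fun_pair.
rewrite ge0_integralZl//; first last.
- by move=> x _; apply: integral_ge0.
- by have := @measurable_fun_fubini_tonelli_G _ _ _ _ _ (@lebesgue_measure R) _ mG; apply.
rewrite -(ge0_integral_plane21 mG)// (ge0_integral_plane12 mG)//.
rewrite ge0_integral_plane12//.
rewrite muleA -EFinM -normfV -normrM -/t.
rewrite -ge0_integralZl//; first last.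
- by move=> x _; apply: integral_ge0.
- by have := @measurable_fun_fubini_tonelli_F _ _ _ _ _ (@lebesgue_measure R) _ mG; apply.
apply: eq_integral => x _.
rewrite (@ge0_integral_affine _ t (c / a * x))//; last first.
  by apply: (measurableT_comp mh); apply: measurable_fun_pair.
by congr (_ * _); apply: eq_integral => y _; rewrite addrC.
Qed.

(** Multiplication by a + i b has the matrix with rows (a, -b) and (b, a), whose determinant is a^2
    + b^2. *)
Lemma ge0_integral_vmul h q : q != (0, 0)%R -> 
  measurable_fun setT h -> (forall x, 0 <= h x) ->
  \int[mu2]_x h x = (enorm q ^+ 2)%:E * \int[mu2]_x h (vmul q x).
Proof.
case: q => a b q0 mh h0; rewrite sqr_enorm /=.
have n0 : (a ^+ 2 + b ^+ 2 != 0)%R.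
  by rewrite -(sqr_enorm (a, b)) sqrf_eq0 enorm_eq0.
have [a0|a0] := eqVneq a 0%R; last first.
  rewrite (@ge0_integral_linear h a (- b) b a)//; last first.
    by rewrite mulNr opprK -!expr2.
  rewrite mulNr opprK -!expr2 ger0_norm ?addr_ge0 ?sqr_ge0//; congr (_ * _).
  by apply: eq_integral => x _; rewrite /vmul /= mulNr.
have b0 : b != 0%R by move: n0; rewrite a0 expr0n add0r sqrf_eq0.
have mh' : measurable_fun setT (fun x : R2 => h (x.2, x.1)).
  by apply: (measurableT_comp mh); exact: measurable_swap.
(* For a = 0 the first pivot is missing. Exchanging the two coordinates of [h] leaves the diagonal
   matrix with entries b and -b. *)
have swapE (g : R2 -> \bar R) : measurable_fun setT g -> (forall x, 0 <= g x) ->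
    \int[mu2]_x g x = \int[mu2]_x g (x.2, x.1).
  move=> mg g0; rewrite ge0_integral_plane12//.
  rewrite [RHS]ge0_integral_plane21//.
  by apply: (measurableT_comp mg); exact: measurable_swap.
rewrite swapE// (@ge0_integral_linear _ b 0 0 (- b))//; last first.
  by rewrite mul0r subr0 mulrN oppr_eq0 mulf_neq0.
rewrite mul0r subr0 mulrN normrN ger0_norm -?expr2 ?sqr_ge0// a0 expr0n add0r.
congr (_ * _); apply: eq_integral => x _; rewrite /vmul /=.
by congr (h (_, _)); ring.
Qed.

Lemma ge0_integral_vadd h y : measurable_fun setT h -> (forall x, 0 <= h x) ->
  \int[mu2]_x h x = \int[mu2]_x h (x.1 + y.1, x.2 + y.2)%R.
Proof.
move=> mh h0; rewrite ge0_integral_plane12// [RHS]ge0_integral_plane12//; last first.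
  by apply: (measurableT_comp mh); apply: measurable_fun_pair;
    apply: measurable_funD.
rewrite (@ge0_integral_affine _ 1%R y.1)//.
- rewrite normr1 mul1e; apply: eq_integral => x1 _ /=.
  rewrite (@ge0_integral_affine _ 1%R y.2)//.
  + rewrite normr1 mul1e; apply: eq_integral => x2 _ /=.
    by rewrite !mul1r.
  + by apply: (measurableT_comp mh); apply: measurable_fun_pair.
- by have := @measurable_fun_fubini_tonelli_F _ _ _ _ _ (@lebesgue_measure R) _ mh; apply.
- by move=> x; apply: integral_ge0.
Qed.

(** Inversion is continuous off 0, and the remaining point is a measurable set on which any function
    is measurable. *)
Lemma measurable_inv : measurable_fun setT (fun x : R => x^-1)%R.
Proof.
rewrite -(setUv [set 0%R : R]); apply/measurable_funU => //.
  exact: measurableC.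
split; first exact: measurable_fun_set1.
apply: open_continuous_measurable_fun.
  apply: closed_openC; apply: accessible_closed_set1.
  by apply: hausdorff_accessible; exact: Rhausdorff.
by move=> x; rewrite inE /= => /eqP x0; exact: inv_continuous.
Qed.

Lemma cmeasurable_toC : cmeasurable_fun setT (@toC R).
Proof. by split; [exact: measurable_fst|exact: measurable_snd]. Qed.

Lemma measurable_enorm d (S : measurableType d) (f : S -> R2) :
  measurable_fun setT f -> measurable_fun setT (fun s => enorm (f s)).
Proof.
by move=> mf; apply: measurable_normc; apply: cmeasurable_comp mf;
  exact: cmeasurable_toC.
Qed.

Lemma measurable_vdiv d (S : measurableType d) (f g : S -> R2) :
  measurable_fun setT f -> measurable_fun setT g ->
  measurable_fun setT (fun s => vdiv (f s) (g s)).
Proof.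
move=> mf mg.
have mi : measurable_fun setT (fun s => (enorm (g s) ^+ 2)^-1)%R.
  apply: (measurableT_comp measurable_inv); apply: measurable_funX.
  exact: measurable_enorm.
have m1 (k : S -> R2) : measurable_fun setT k -> measurable_fun setT (fun s => (k s).1).
  by move=> mk; exact: (measurableT_comp measurable_fst).
have m2 (k : S -> R2) : measurable_fun setT k -> measurable_fun setT (fun s => (k s).2).
  by move=> mk; exact: (measurableT_comp measurable_snd).
under eq_fun do rewrite vdivE.
apply: measurable_fun_pair; apply: measurable_funM => //.
- by apply: measurable_funD; apply: measurable_funM; auto.
- by apply: measurable_funB; apply: measurable_funM; auto.
Qed.

Lemma measurable_vmul d (S : measurableType d) (f g : S -> R2) :
  measurable_fun setT f -> measurable_fun setT g ->
  measurable_fun setT (fun s => vmul (f s) (g s)).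
Proof.
move=> mf mg.
have m1 (k : S -> R2) : measurable_fun setT k -> measurable_fun setT (fun s => (k s).1).
  by move=> mk; exact: (measurableT_comp measurable_fst).
have m2 (k : S -> R2) : measurable_fun setT k -> measurable_fun setT (fun s => (k s).2).
  by move=> mk; exact: (measurableT_comp measurable_snd).
apply: measurable_fun_pair.
- by apply: measurable_funB; apply: measurable_funM; auto.
- by apply: measurable_funD; apply: measurable_funM; auto.
Qed.

Lemma ge0_fubini_plane (h : R2 * R2 -> \bar R) :
  measurable_fun setT h -> (forall z, 0 <= h z) ->
  \int[mu2]_x \int[mu2]_y h (x, y) = \int[mu2]_y \int[mu2]_x h (x, y).
Proof.
move=> mh h0; exact: (@fubini_tonelli _ _ (measurableTypeR R * measurableTypeR R)%type
  (measurableTypeR R * measurableTypeR R)%type R (@lebesgue2 R) (@lebesgue2 R) h mh h0).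
Qed.

Lemma ge0_tonelli_plane (h : R2 * R2 -> \bar R) :
  measurable_fun setT h -> (forall z, 0 <= h z) ->
  \int[(mu2 \x mu2)%E]_z h z = \int[mu2]_x \int[mu2]_y h (x, y).
Proof.
move=> mh h0; exact: (@fubini_tonelli1 _ _ (measurableTypeR R * measurableTypeR R)%type
  (measurableTypeR R * measurableTypeR R)%type R (@lebesgue2 R) (@lebesgue2 R) h mh h0).
Qed.

(* [x = q y] at fixed [q], then [q = x / y] at fixed [y]. *)
Lemma ge0_integral_dilation (G : R2 * R2 -> \bar R) :
  measurable_fun setT G -> (forall z, 0 <= G z) -> (forall x, G (x, (0, 0)%R) = 0) ->
  \int[mu2]_q \int[mu2]_x G (x, vdiv x q) =
  \int[mu2]_y \int[mu2]_x ((enorm x ^+ 2 / enorm y ^+ 4)%:E * G (x, y)).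
Proof.
move=> mG G0 Gz.
have mvm : measurable_fun setT (fun z : R2 * R2 => G (vmul z.1 z.2, z.2)).
  apply: (measurableT_comp mG); apply: measurable_fun_pair => //.
  exact: measurable_vmul.
have me2 : measurable_fun setT (fun z : R2 * R2 => (enorm z.1 ^+ 2)%:E).
  apply/measurable_EFinP/measurable_funX; exact: measurable_enorm.
transitivity (\int[mu2]_q \int[mu2]_y ((enorm q ^+ 2)%:E * G (vmul q y, y))).
  apply: eq_integral => q _.
  (* The substitution degenerates at q = 0, but both sides are 0 there: on the left because x/0 is
     the origin, on the right because of the weight |q|^2. *)
  have [->|q0] := eqVneq q (0, 0)%R.
    rewrite integral0_eq => [|x _]; last by rewrite vdivr0 Gz.
    by rewrite integral0_eq// => x _; rewrite enorm0 expr0n mul0e.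
  rewrite (@ge0_integral_vmul (fun x => G (x, vdiv x q)) q)//; last first.
    apply: (measurableT_comp mG); apply: measurable_fun_pair => //.
    exact: measurable_vdiv.
  rewrite ge0_integralZl//; first last.
  - by rewrite lee_fin sqr_ge0.
  - apply: (measurableT_comp mG); apply: measurable_fun_pair => //.
      exact: measurable_vmul.
  by congr (_ * _); apply: eq_integral => y _; rewrite vdiv_vmul.
transitivity (\int[mu2]_y \int[mu2]_q ((enorm q ^+ 2)%:E * G (vmul q y, y))).
  apply: (@ge0_fubini_plane (fun z : R2 * R2 =>
      (enorm z.1 ^+ 2)%:E * G (vmul z.1 z.2, z.2))).
  - exact: emeasurable_funM.
  - by move=> z; rewrite mule_ge0// lee_fin sqr_ge0.
apply: eq_integral => y _.
have [->|y0] := eqVneq y (0, 0)%R.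
  rewrite integral0_eq => [|x _]; last by rewrite Gz mule0.
  by rewrite integral0_eq// => x _; rewrite Gz mule0.
have ny0 : enorm y != 0%R by rewrite enorm_eq0.
(* Read backwards: x = y q at fixed y has Jacobian |y|^2, and |y|^2 |x|^2 / |y|^4 = |q|^2. *)
rewrite (@ge0_integral_vmul (fun x => (enorm x ^+ 2 / enorm y ^+ 4)%:E * G (x, y)) y)//;
  first last.
- by move=> x; rewrite mule_ge0// lee_fin divr_ge0// ?sqr_ge0// exprn_ge0// enorm_ge0.
- apply: emeasurable_funM.
    by apply/measurable_EFinP/measurable_funM => //; apply: measurable_funX;
      exact: measurable_enorm.
  by apply: (measurableT_comp mG); exact: measurable_fun_pair.
rewrite -ge0_integralZl//; first last.
- by rewrite lee_fin sqr_ge0.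
- by move=> x _; rewrite mule_ge0// lee_fin divr_ge0// ?sqr_ge0// exprn_ge0// enorm_ge0.
- apply: emeasurable_funM.
    apply/measurable_EFinP/measurable_funM => //; apply: measurable_funX.
    by apply: measurable_enorm; exact: measurable_vmul.
  apply: (measurableT_comp mG); apply: measurable_fun_pair => //.
  exact: measurable_vmul.
apply: eq_integral => q _; rewrite muleA -EFinM enorm_vmul.
have -> : vmul y q = vmul q y by apply: toC_inj; rewrite !toC_vmul mulrC.
by congr (_%:E * _); field.
Qed.

End PlaneChangeOfVariables.

(** * Abel summation of Fourier integrals *)

Section AbelKernel.
Variable R : realType.
Notation mu := (@lebesgue_measure R).
Implicit Types s t e : R.

Lemma expiD s t : expi (s + t) = expi s * expi t.
Proof.
apply: eqc; rewrite ?cReM ?cImM /expi /= ?cosD ?sinD//.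
by rewrite addrC.
Qed.

Lemma conj_expi t : (expi t)^* = expi (- t).
Proof. by apply: eqc; rewrite ?cRe_conj ?cIm_conj /expi /= ?cosN ?sinN. Qed.

Lemma normc_expi t : normc (expi t) = 1.
Proof. by rewrite /expi /= cos2Dsin2 sqrtr1. Qed.

Lemma cmeasurable_expi d (S : measurableType d) (f : S -> R) :
  measurable_fun setT f -> cmeasurable_fun setT (fun x => expi (f x)).
Proof.
move=> mf; split => /=.
- apply: (measurableT_comp (f := cos)) => //.
  by apply: continuous_measurable_fun; exact: continuous_cos.
- apply: (measurableT_comp (f := sin)) => //.
  by apply: continuous_measurable_fun; exact: continuous_sin.
Qed.

Definition abel e t : R := expR (- e * `|t|).

(** Left unnormalised, with total mass 2 pi; in the plane this becomes the factor (2 pi)^2 of Bessel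
    and Parseval. *)
Definition poisson e s : R := 2 * e / (e ^+ 2 + s ^+ 2).

Lemma abel_ge0 e t : 0 <= abel e t. Proof. exact: expR_ge0. Qed.

Lemma abel_le1 e t : 0 <= e -> abel e t <= 1.
Proof. by move=> e0; rewrite -expR0 ler_expR mulNr oppr_le0 mulr_ge0. Qed.

Lemma continuous_abel e : continuous (abel e).
Proof.
move=> t; apply: (@continuous_comp _ _ _ (fun t : R => - e * `|t|) expR).
  by apply: continuousM; [exact: cvg_cst|exact: norm_continuous].
exact: continuous_expR.
Qed.

Lemma measurable_abel e : measurable_fun setT (abel e).
Proof. by apply: continuous_measurable_fun; exact: continuous_abel. Qed.

Lemma cvg_expR_lin e : 0 < e -> expR (- e * x) @[x --> +oo] --> (0 : R).
Proof.
move=> e0; under eq_fun do rewrite mulNr.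
apply: (@cvg_comp _ _ _ (fun x => e * x) (fun x => expR (- x)) +oo +oo (nbhs (0 : R)));
  last exact: cvgr_expR.
exact: gt0_cvgMry.
Qed.

Let is_derive_lin (c x : R) : is_derive x 1 (fun t : R => c * t) c.
Proof.
have := @is_deriveM R R (cst c) id x 1 _ _ (is_derive_cst c x 1) (is_derive_id x 1).
by move=> h; apply: (is_derive_eq h); rewrite scaler0 addr0 /GRing.scale /= mulr1.
Qed.

(** The first term integrates the exponential, the second its product with the cosine, as two
    integrations by parts show. *)
Let abel_prim e s (x : R) : R := - e^-1 * expR (- e * x) +
  (e ^+ 2 + s ^+ 2)^-1 * (expR (- e * x) * (s * sin (s * x) - e * cos (s * x))).

Let is_derive_abel_prim e s (x : R) : e != 0 -> e ^+ 2 + s ^+ 2 != 0 ->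
  is_derive x 1 (abel_prim e s) (expR (- e * x) * (1 + cos (s * x))).
Proof.
move=> e0 es0.
have dE : is_derive x 1 (fun t : R => expR (- e * t)) (- e * expR (- e * x)).
  have := @is_derive1_comp R expR (fun t : R => - e * t) x _ _ (is_derive_expR _)
    (is_derive_lin (- e) x).
  by move=> h; apply: (is_derive_eq h); rewrite mulrC.
have dS : is_derive x 1 (fun t : R => sin (s * t)) (s * cos (s * x)).
  have := @is_derive1_comp R sin (fun t : R => s * t) x _ _ (is_derive_sin _)
    (is_derive_lin s x).
  by move=> h; apply: (is_derive_eq h); rewrite mulrC.
have dC : is_derive x 1 (fun t : R => cos (s * t)) (- s * sin (s * x)).
  have := @is_derive1_comp R cos (fun t : R => s * t) x _ _ (is_derive_cos _)
    (is_derive_lin s x).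
  by move=> h; apply: (is_derive_eq h); ring.
have cM (c : R) (f : R -> R) df : is_derive x 1 f df ->
    is_derive x 1 (fun t => c * f t) (c * df).
  move=> h; have := is_deriveZ c h; by [].
rewrite /abel_prim.
have h1 := cM (- e^-1) _ _ dE.
have h2 := is_deriveB (cM s _ _ dS) (cM e _ _ dC).
have h3 := cM (e ^+ 2 + s ^+ 2)^-1 _ _ (is_deriveM dE h2).
have h4 := is_deriveD h1 h3.
apply: (is_derive_eq h4); rewrite /GRing.scale /=.
rewrite [X in _ + _ * (_ + X * _)](_ : _ = s * sin (s * x) - e * cos (s * x))//.
by field; rewrite e0 es0.
Qed.

(** The added 1 makes the integrand nonnegative, as required both for folding the line onto the
    half-line and for the fundamental theorem there. The case s = 0 then gives the integral of
    [abel], which can be subtracted. *)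
Lemma integral_abel_cos e s : 0 < e ->
  (\int[mu]_t (abel e t * (1 + cos (s * t)))%:E =
   (2 * (e^-1 + e / (e ^+ 2 + s ^+ 2)))%:E)%E.
Proof.
move=> e0.
have es_gt0 : 0 < e ^+ 2 + s ^+ 2 by rewrite ltr_pwDl ?exprn_gt0// sqr_ge0.
have es0 := lt0r_neq0 es_gt0; have en0 := lt0r_neq0 e0.
have cc : continuous (fun t : R => 1 + cos (s * t)).
  move=> x; apply: cvgD; first exact: cvg_cst.
  apply: (@continuous_comp _ _ _ (fun t : R => s * t) cos).
    by apply: cvgM; [exact: cvg_cst|exact: cvg_id].
  exact: continuous_cos.
have cE : continuous (fun t : R => expR (- e * t)).
  move=> x; apply: (@continuous_comp _ _ _ (fun t : R => - e * t) expR).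
    by apply: cvgM; [exact: cvg_cst|exact: cvg_id].
  exact: continuous_expR.
have c0 t : 0 <= 1 + cos (s * t) by rewrite addrC -lerBlDr sub0r cos_geN1.
rewrite ge0_symfun_integralT; first last.
- by move=> t; rewrite /abel /= normrN mulrN cosN.
- by move=> t; apply: cvgM; [exact: continuous_abel|exact: cc].
- by move=> t; rewrite mulr_ge0// abel_ge0.
rewrite -set_itvcy EFinM; congr (_ * _)%E.
transitivity (\int[mu]_(x in `[0%R, +oo[) (expR (- e * x) * (1 + cos (s * x)))%:E)%E.
  apply: eq_integral => x; rewrite inE /= in_itv /= andbT => x0.
  by rewrite /abel ger0_norm.
have cf : continuous (fun x : R => expR (- e * x) * (1 + cos (s * x))).
  by move=> x; apply: cvgM; [exact: cE|exact: cc].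
have dF x := @is_derive_abel_prim e s x en0 es0.
rewrite (@ge0_continuous_FTC2y _ _ (abel_prim e s) 0 0).
- rewrite /abel_prim !mulr0 expR0 sin0 cos0 mulr0 !mulr1 mul1r sub0r.
  by rewrite -EFinB; congr EFin; ring.
- by move=> x _; rewrite mulr_ge0// expR_ge0.
- exact: continuous_subspaceT.
- have -> : (0 : R) = - e^-1 * 0 + (e ^+ 2 + s ^+ 2)^-1 * 0 by rewrite !mulr0 addr0.
  apply: cvgD; apply: cvgMl_tmp; first exact: cvg_expR_lin.
  (* Bounds |s sin - e cos|, so that the oscillating term of the antiderivative decays with the
     exponential. *)
  pose M := `|s| + e.
  apply: (@squeeze_cvgr _ _ _ _ (fun x => - M * expR (- e * x)) (fun x => M * expR (- e * x))).
  + apply: nearW => x; rewrite mulNr -ler_norml normrM mulrC.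
    rewrite (ger0_norm (expR_ge0 _)) ler_wpM2r ?expR_ge0//.
    rewrite (le_trans (ler_normB _ _))// !normrM (gtr0_norm e0) lerD//.
      by rewrite ler_piMr// ler_norml sin_geN1 sin_le1.
    by rewrite ler_piMr ?(ltW e0)// ler_norml cos_geN1 cos_le1.
  + by rewrite -(mulr0 (- M)); apply: cvgMl_tmp; exact: cvg_expR_lin.
  + by rewrite -(mulr0 M); apply: cvgMl_tmp; exact: cvg_expR_lin.
- by move=> x _; apply: ex_derive.
- apply: cvg_at_right_filter; apply: differentiable_continuous.
  by apply/derivable1_diffP; exact: ex_derive.
- by move=> x _; rewrite derive1E; exact: derive_val.
Qed.

Lemma integral_abel e : 0 < e -> (\int[mu]_t (abel e t)%:E = (2 / e)%:E)%E.
Proof.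
move=> e0; have := integral_abel_cos 0 e0.
have -> : 2 * (e^-1 + e / (e ^+ 2 + 0 ^+ 2)) = 2 * (2 / e) :> R.
  by rewrite expr0n addr0; field; exact: lt0r_neq0.
under eq_integral do rewrite mul0r cos0 (mulrC (abel _ _)) -[1 + 1]/(2%:R) EFinM.
rewrite ge0_integralZl//; first last.
- by move=> t _; rewrite lee_fin abel_ge0.
- by apply/measurable_EFinP; exact: measurable_abel.
move=> /(congr1 (fun x => (2^-1)%:E * x)%E).
rewrite muleA -!EFinM mulrA mulVf ?mul1r// mul1e => ->; congr EFin.
by field; exact: lt0r_neq0.
Qed.

Lemma cintegrable_abel e : 0 < e ->
  cintegrable mu setT (fun t => (abel e t)%:C).
Proof.
move=> e0; apply: cintegrable_lty => //.
  by apply: cmeasurable_real; exact: measurable_abel.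
under eq_integral do rewrite normc_real ger0_norm ?abel_ge0//.
by rewrite integral_abel// ltry.
Qed.

(* The sine part vanishes by parity. *)
Lemma cintegral_abel_expi e s : 0 < e ->
  cintegral mu setT (fun t => expi (t * s) * (abel e t)%:C) = (poisson e s)%:C.
Proof.
move=> e0.
have ai := cintegrable_abel e0.
have mex : cmeasurable_fun setT (fun t => expi (t * s) : R[i]).
  by apply: cmeasurable_expi; exact: mulrr_measurable.
have fi : cintegrable mu setT (fun t => expi (t * s) * (abel e t)%:C).
  by apply: (@cintegrable_boundM _ _ _ mu setT measurableT _ _ 1) => // t _;
    rewrite normc_expi.
apply: eqc => /=.
- have [fr _] := fi; have [ar _] := ai.
  have iA : mu.-integrable setT (EFin \o abel e) by exact: ar.
  (* Adding the integral of [abel] to the cosine integral produces the integrand 1 + cos computed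
     before. *)
  have E : Rintegral mu setT (fun t => complex.Re (expi (t * s) * (abel e t)%:C)) +
     Rintegral mu setT (abel e) = 2 * (e^-1 + e / (e ^+ 2 + s ^+ 2)).
    rewrite -RintegralD// /Rintegral.
    rewrite -[RHS]/(fine (_%:E)) -(integral_abel_cos s e0); congr fine.
    apply: eq_integral => t _; congr EFin.
    rewrite cReM /= mulr0 subr0 (mulrC s) -/(abel e t); ring.
  have E2 : Rintegral mu setT (abel e) = 2 / e by rewrite /Rintegral integral_abel.
  apply/eqP; rewrite -(inj_eq (@addIr _ (2 / e))) -{1}E2 E; apply/eqP.
  by rewrite /poisson; ring.
- set f := fun t => _; pose I := Rintegral mu setT f.
  suff : I = - I by move=> /eqP; rewrite -addr_eq0 -mulr2n mulrn_eq0 /= => /eqP.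
  have [_ fim] := fi.
  rewrite {2}/I -[RHS]mulN1r -RintegralZl// /I.
  have N1 : (-1 : R) != 0 by rewrite oppr_eq0 oner_eq0.
  have := @cintegral_change_of_variables R _ _ _ _ mu mu (fun t : R => -1 * t + 0)
    (fun=> 1) set0 (fun=> ler01) _ (fun t => (f t)%:C).
  rewrite !cintegral_real => h.
  have {}h : Rintegral mu setT (fun t => f (-1 * t + 0)) = Rintegral mu setT f.
    have := congr1 (@complex.Re R) (h _ _ _).
    rewrite /= => ->//.
    + apply: eq_Rintegral => t _; by rewrite /= ?mul1r ?mul0r ?subr0.
    + move=> g mg g0 _; rewrite [RHS](@ge0_integral_affine _ (-1) 0)//.
      * rewrite normrN1 mul1e; apply: eq_integral => t _; by rewrite /= mul1e.
      * by under eq_fun do rewrite mul1e.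
      * by move=> y; rewrite mul1e.
    + by apply: cmeasurable_real; apply/measurable_EFinP; exact: measurable_int fim.
  rewrite -h; apply: eq_Rintegral => t _; rewrite /f !mulr0 !add0r addr0.
  by rewrite (mulN1r t) mulNr sinN /abel normrN; ring.
Qed.

Lemma poisson_ge0 e s : 0 < e -> 0 <= poisson e s.
Proof.
by move=> e0; rewrite divr_ge0 ?addr_ge0 ?sqr_ge0// mulr_ge0// ltW.
Qed.

(** The kernel is largest at s = 0. Boundedness at fixed [e] makes its product with two integrable
    functions integrable. *)
Lemma poisson_le e s : 0 < e -> poisson e s <= 2 / e.
Proof.
move=> e0; rewrite /poisson ler_pdivrMr ?ltr_pwDl ?exprn_gt0 ?sqr_ge0//.
rewrite -subr_ge0 (_ : _ - _ = 2 * s ^+ 2 / e).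
  by rewrite divr_ge0 ?(ltW e0)// mulr_ge0// sqr_ge0.
by field; exact: lt0r_neq0.
Qed.

Lemma measurable_poisson e : measurable_fun setT (poisson e).
Proof.
apply: measurable_funM => //; apply: (measurableT_comp (@measurable_inv R)).
by apply: measurable_funD => //; exact: measurable_funX.
Qed.

(** Twice the half-line integral of 2 / (1 + s^2), an arctangent. The case e = 1 suffices, the
    others being reached by scaling. *)
Lemma integral_poisson : (\int[mu]_s (poisson 1 s)%:E = (2 * pi)%:E)%E.
Proof.
rewrite ge0_symfun_integralT; first last.
- by move=> s; rewrite /poisson /= sqrrN.
- move=> s; apply: cvgM; first exact: cvg_cst.
  rewrite expr1n; exact: continuous_oneDsqrV.
- by move=> s; exact: poisson_ge0.
rewrite -set_itvcy.
under eq_integral do rewrite /poisson expr1n mulr1 EFinM.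
rewrite ge0_integralZl//; first last.
- by move=> x _; rewrite lee_fin invr_ge0 addr_ge0// sqr_ge0.
- by apply/measurable_EFinP; apply: measurable_funTS; apply: continuous_measurable_fun;
    exact: continuous_oneDsqrV.
rewrite (@integral0y_oneDsqr R) -!EFinM; congr EFin.
by field.
Qed.

End AbelKernel.

(** * Bessel and Parseval *)

Section PlaneIntegrals.
Variable R : realType.
Local Notation R2 := (R * R)%type.
Local Notation mu := (@lebesgue_measure R).
Local Notation mu2 := (@lebesgue2 R).

Lemma cintegral_plane12 (f : R2 -> R[i]) : cintegrable mu2 setT f ->
  cintegral mu2 setT f =
  cintegral mu setT (fun x => cintegral mu setT (fun y => f (x, y))).
Proof.
by move=> fi; exact/esym/(@cintegral12 R _ _ (measurableTypeR R) (measurableTypeR R) mu mu f fi).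
Qed.

Lemma cintegrable_plane_tensor (G H : R -> R[i]) :
  cintegrable mu setT G -> cintegrable mu setT H ->
  cintegrable mu2 setT (fun z : R2 => G z.1 * H z.2).
Proof.
move=> Gi Hi.
have := @cintegrable_tensor R _ _ (measurableTypeR R) (measurableTypeR R) mu mu
  (fun=> 1) G H 1 _ _ Gi Hi.
have -> : (fun z : R2 => 1 * (G z.1 * H z.2)) = (fun z => G z.1 * H z.2).
  by apply/funext => z; rewrite mul1r.
apply; first exact: cmeasurable_cst.
by move=> _; rewrite normc1.
Qed.

Lemma cintegral_plane_tensor (G H : R -> R[i]) :
  cintegrable mu setT G -> cintegrable mu setT H ->
  cintegral mu2 setT (fun z : R2 => G z.1 * H z.2) =
  cintegral mu setT G * cintegral mu setT H.
Proof.
move=> Gi Hi; rewrite cintegral_plane12; last exact: cintegrable_plane_tensor.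
under eq_cintegral => x _ do rewrite /= cintegralZ//.
under eq_cintegral => x _ do rewrite mulrC.
by rewrite cintegralZ// mulrC.
Qed.

Lemma cintegral_swap_plane (f : R2 * R2 -> R[i]) :
  cintegrable (mu2 \x mu2)%E setT f ->
  cintegral mu2 setT (fun x => cintegral mu2 setT (fun y => f (x, y))) =
  cintegral mu2 setT (fun y => cintegral mu2 setT (fun x => f (x, y))).
Proof. exact: (@cintegral_swap _ _ _ _ _ mu2 mu2). Qed.

Lemma cintegrable_tensor_plane (E : R2 * R2 -> R[i]) (G H : R2 -> R[i]) (M : R) :
  cmeasurable_fun setT E -> (forall z, normc (E z) <= M) ->
  cintegrable mu2 setT G -> cintegrable mu2 setT H ->
  cintegrable (mu2 \x mu2)%E setT (fun z => E z * (G z.1 * H z.2)).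
Proof. exact: (@cintegrable_tensor _ _ _ _ _ mu2 mu2). Qed.

Lemma cmeasurable_cintegral_plane (f : R2 * R2 -> R[i]) :
  cmeasurable_fun setT f ->
  cmeasurable_fun setT (fun x => cintegral mu2 setT (fun y => f (x, y))).
Proof. exact: (@cmeasurable_cintegral _ _ _ _ _ mu2). Qed.

End PlaneIntegrals.

(** * The Fourier transform of integrable functions on the plane *)

Section FourierTransform.
Variable R : realType.
Local Notation R2 := (R * R)%type.
Local Notation mu := (@lebesgue_measure R).
Local Notation mu2 := (@lebesgue2 R).
Implicit Types (a b : R2 -> R[i]) (p x y u : R2).

(** The phase has the sign of [U], and there is no normalising constant. *)
Definition FT a p : R[i] := cintegral mu2 setT (fun x => expi (dotp p x) * a x).

Definition vsub (x y : R2) : R2 := (x.1 - y.1, x.2 - y.2).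

Lemma measurable_dotp d (S : measurableType d) (f g : S -> R2) :
  measurable_fun setT f -> measurable_fun setT g ->
  measurable_fun setT (fun s => dotp (f s) (g s)).
Proof.
move=> mf mg.
have m1 (k : S -> R2) : measurable_fun setT k -> measurable_fun setT (fun s => (k s).1).
  by move=> mk; exact: (measurableT_comp measurable_fst).
have m2 (k : S -> R2) : measurable_fun setT k -> measurable_fun setT (fun s => (k s).2).
  by move=> mk; exact: (measurableT_comp measurable_snd).
by apply: measurable_funD; apply: measurable_funM; auto.
Qed.

Lemma cmeasurable_expi_dotp d (S : measurableType d) (f g : S -> R2) :
  measurable_fun setT f -> measurable_fun setT g ->
  cmeasurable_fun setT (fun s => expi (dotp (f s) (g s))).
Proof. by move=> mf mg; apply: cmeasurable_expi; exact: measurable_dotp. Qed.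

Lemma cintegrable_expi_mul a p : cintegrable mu2 setT a ->
  cintegrable mu2 setT (fun x => expi (dotp p x) * a x).
Proof.
move=> ia; apply: (@cintegrable_boundM _ _ _ mu2 setT measurableT _ _ 1) => //.
- by apply: cmeasurable_expi_dotp.
- by move=> x _; rewrite normc_expi.
Qed.

Lemma cintegrable_expi_mulr a x : cintegrable mu2 setT a ->
  cintegrable mu2 setT (fun p => expi (dotp p x) * a p).
Proof.
move=> ia; apply: (@cintegrable_boundM _ _ _ mu2 setT measurableT _ _ 1) => //.
- by apply: cmeasurable_expi_dotp.
- by move=> p _; rewrite normc_expi.
Qed.

Lemma cmeasurable_FT a : cmeasurable_fun setT a -> cmeasurable_fun setT (FT a).
Proof.
move=> ma; apply: (@cmeasurable_cintegral_plane R (fun z => expi (dotp z.1 z.2) * a z.2)).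
apply: cmeasurableM => //; first exact: cmeasurable_expi_dotp.
exact: cmeasurable_comp.
Qed.

Lemma FT_bounded a : cintegrable mu2 setT a ->
  exists M, forall p, normc (FT a p) <= M.
Proof.
move=> ia; exists (2 * Rintegral mu2 setT (fun x => normc (a x))) => p.
rewrite (le_trans (normc_cintegral_le measurableT (cintegrable_expi_mul p ia)))//.
rewrite ler_pM2l// le_eqVlt; apply/orP; left; apply/eqP.
by apply: eq_Rintegral => x _; rewrite normcM normc_expi mul1r.
Qed.

Definition abel2 e p : R := abel e p.1 * abel e p.2.

Definition poisson2 e u : R := poisson e u.1 * poisson e u.2.

Lemma abel2_ge0 e p : 0 <= abel2 e p.
Proof. by rewrite mulr_ge0// abel_ge0. Qed.

Lemma abel2_le1 e p : 0 <= e -> abel2 e p <= 1.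
Proof.
move=> e0; rewrite -(mulr1 1) ler_pM ?abel_ge0 ?abel_le1//.
Qed.

Lemma measurable_abel2 e : measurable_fun setT (abel2 e).
Proof.
apply: measurable_funM.
- exact: (measurableT_comp (@measurable_abel R e) measurable_fst).
- exact: (measurableT_comp (@measurable_abel R e) measurable_snd).
Qed.

Lemma measurable_poisson2 e : measurable_fun setT (poisson2 e).
Proof.
apply: measurable_funM.
- exact: (measurableT_comp (@measurable_poisson R e) measurable_fst).
- exact: (measurableT_comp (@measurable_poisson R e) measurable_snd).
Qed.

Lemma cintegrable_abel2 e : 0 < e -> cintegrable mu2 setT (fun p => (abel2 e p)%:C).
Proof.
move=> e0; have ai := cintegrable_abel e0.
have := cintegrable_plane_tensor ai ai; apply: eq_cintegrable => // z _.
by rewrite -realcM.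
Qed.

Lemma cintegral_abel2_expi e u : 0 < e ->
  cintegral mu2 setT (fun p => expi (dotp p u) * (abel2 e p)%:C) = (poisson2 e u)%:C.
Proof.
move=> e0; rewrite /poisson2 realcM -!cintegral_abel_expi//.
have gi s : cintegrable mu setT (fun t => expi (t * s) * (abel e t)%:C).
  apply: (@cintegrable_boundM _ _ _ mu setT measurableT _ _ 1) => //.
  - exact: cintegrable_abel.
  - by apply: cmeasurable_expi; exact: mulrr_measurable.
  - by move=> t _; rewrite normc_expi.
rewrite -(cintegral_plane_tensor (gi u.1) (gi u.2)).
by apply: eq_cintegral => p _; rewrite /dotp expiD /abel2 realcM mulrACA.
Qed.

Lemma poisson2_ge0 e u : 0 < e -> 0 <= poisson2 e u.
Proof. by move=> e0; rewrite mulr_ge0// poisson_ge0. Qed.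

Lemma poisson2_le e u : 0 < e -> poisson2 e u <= (2 / e) ^+ 2.
Proof. by move=> e0; rewrite expr2 ler_pM ?poisson_ge0 ?poisson_le. Qed.

Lemma integral_poisson2 :
  (\int[mu2]_u (poisson2 1 u)%:E = ((2 * pi) ^+ 2)%:E)%E.
Proof.
rewrite ge0_integral_plane12; first last.
- by move=> u; rewrite lee_fin poisson2_ge0.
- by apply/measurable_EFinP; exact: measurable_poisson2.
under eq_integral => x _.
  under eq_integral do rewrite /poisson2 /= EFinM.
  rewrite ge0_integralZl//; first last.
  - by rewrite lee_fin poisson_ge0.
  - by move=> y _; rewrite lee_fin poisson_ge0.
  - by apply/measurable_EFinP; exact: measurable_poisson.
  rewrite integral_poisson.
  over.
rewrite ge0_integralZr//; first last.
- by rewrite lee_fin mulr_ge0// pi_ge0.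
- by move=> y _; rewrite lee_fin poisson_ge0.
- by apply/measurable_EFinP; exact: measurable_poisson.
by rewrite integral_poisson -EFinM expr2.
Qed.

Lemma dotp_vsub p x y : dotp p (vsub x y) = dotp p x - dotp p y.
Proof. by rewrite /dotp /vsub /=; ring. Qed.

Lemma measurable_vsub d (S : measurableType d) (f g : S -> R2) :
  measurable_fun setT f -> measurable_fun setT g ->
  measurable_fun setT (fun s => vsub (f s) (g s)).
Proof.
move=> mf mg; apply: measurable_fun_pair; apply: measurable_funB.
- exact: (measurableT_comp measurable_fst).
- exact: (measurableT_comp measurable_fst).
- exact: (measurableT_comp measurable_snd).
- exact: (measurableT_comp measurable_snd).
Qed.

(** Both transforms are expanded and the integral over [p] is taken first; the Abel weight makes the
    triple integral absolutely convergent and yields the kernel at x - y. *)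
Lemma regularized_parseval a b e : 0 < e ->
  cintegrable mu2 setT a -> cintegrable mu2 setT b ->
  cintegral mu2 setT (fun p => (abel2 e p)%:C * (FT a p * (FT b p)^*)) =
  cintegral mu2 setT (fun x => cintegral mu2 setT (fun y =>
    (poisson2 e (vsub x y))%:C * (a x * (b y)^*))).
Proof.
move=> e0 ia ib.
have iphi := cintegrable_abel2 e0.
have ma := cintegrable_measurable measurableT ia.
have mb := cintegrable_measurable measurableT ib.
have [Mb bM] := FT_bounded ib.
(* Kept as one integrable function of [p], so that the first exchange involves only [p] and [x]; the
   transform of [b] is expanded for the second exchange. *)
pose c p := (FT b p)^* * (abel2 e p)%:C.
have ic : cintegrable mu2 setT c.
  apply: (@cintegrable_boundM _ _ _ mu2 setT measurableT _ _ Mb) => //.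
  - by apply: cmeasurable_conj; exact: cmeasurable_FT.
  - by move=> p _; rewrite normc_conj.
transitivity (cintegral mu2 setT (fun p => cintegral mu2 setT (fun x =>
    expi (dotp p x) * (c p * a x)))).
  apply: eq_cintegral => p _.
  transitivity (c p * FT a p); first by rewrite /c; ring.
  rewrite /FT -cintegralZ//; last exact: cintegrable_expi_mul.
  by apply: eq_cintegral => x _; ring.
rewrite (cintegral_swap_plane (f := fun z => expi (dotp z.1 z.2) * (c z.1 * a z.2)));
  last first.
  apply: (@cintegrable_tensor_plane _ _ _ _ 1) => //.
  - by apply: cmeasurable_expi_dotp.
  - by move=> z; rewrite normc_expi.
apply: eq_cintegral => x _ /=.
transitivity (cintegral mu2 setT (fun p => cintegral mu2 setT (fun y =>
    expi (dotp p (vsub x y)) * ((abel2 e p)%:C * (a x * (b y)^*))))).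
  apply: eq_cintegral => p _.
  rewrite (_ : c p = cintegral mu2 setT (fun y => (expi (dotp p y) * b y)^*) *
      (abel2 e p)%:C); last by rewrite cintegral_conj//; exact: cintegrable_expi_mul.
  rewrite (_ : expi _ * _ = (expi (dotp p x) * (abel2 e p)%:C * a x) *
    cintegral mu2 setT (fun y => (expi (dotp p y) * b y)^*)); last by ring.
  rewrite -cintegralZ//; last by apply: cintegrable_conj => //; exact: cintegrable_expi_mul.
  apply: eq_cintegral => y _.
  by rewrite dotp_vsub expiD -conj_expi conjcM; ring.
rewrite (cintegral_swap_plane (f := fun z => expi (dotp z.1 (vsub x z.2)) *
   ((abel2 e z.1)%:C * (a x * (b z.2)^*)))); last first.
  apply: (@cintegrable_tensor_plane _ _ (fun p => (abel2 e p)%:C)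
    (fun y => a x * (b y)^*) 1) => //.
  - by apply: cmeasurable_expi_dotp => //; exact: measurable_vsub.
  - by move=> z; rewrite normc_expi.
  - by apply: cintegrableZ => //; exact: cintegrable_conj.
apply: eq_cintegral => y _ /=.
rewrite -cintegral_abel2_expi// [in RHS]mulrC -cintegralZ//; last first.
  exact: cintegrable_expi_mulr.
by apply: eq_cintegral => p _; ring.
Qed.

(** The substitution x = y + e u replaces the kernel at scale [e] centred at [y] by the fixed kernel
    at scale 1, so that limits in [e] act on the other factor only. *)
Definition dil (e : R) (y u : R2) : R2 := (y.1 + e * u.1, y.2 + e * u.2).

Lemma measurable_dil e d (S : measurableType d) (f g : S -> R2) :
  measurable_fun setT f -> measurable_fun setT g ->
  measurable_fun setT (fun s => dil e (f s) (g s)).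
Proof.
move=> mf mg; apply: measurable_fun_pair; apply: measurable_funD.
- exact: (measurableT_comp measurable_fst).
- by apply: measurable_funM => //; exact: (measurableT_comp measurable_fst).
- exact: (measurableT_comp measurable_snd).
- by apply: measurable_funM => //; exact: (measurableT_comp measurable_snd).
Qed.

Lemma cvg_dil y v : dil n.+1%:R^-1 y v @[n --> \oo] --> y.
Proof.
case: y => y1 y2.
have c1 (s t : R) : s + n.+1%:R^-1 * t @[n --> \oo] --> s.
  rewrite [X in _ --> X](_ : s = s + 0 * t); last by rewrite mul0r addr0.
  by apply: cvgD; [exact: cvg_cst|apply: cvgMr_tmp; exact: cvg_harmonic].
exact: (cvg_pair (c1 y1 v.1) (c1 y2 v.2)).
Qed.

Lemma ge0_integral_dil e y (h : R2 -> \bar R) : 0 < e ->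
  measurable_fun setT h -> (forall x, (0 <= h x)%E) ->
  (\int[mu2]_x h x = (e ^+ 2)%:E * \int[mu2]_u h (dil e y u))%E.
Proof.
move=> e0 mh h0; rewrite (ge0_integral_vadd y mh h0).
have me : measurable_fun setT (fun x : R2 => h (x.1 + y.1, x.2 + y.2)).
  by apply: (measurableT_comp mh); apply: measurable_fun_pair;
    apply: measurable_funD.
rewrite (@ge0_integral_vmul _ _ (e, 0) _ me)//; last first.
  by apply/eqP => -[] /eqP; rewrite gt_eqF.
rewrite sqr_enorm /= expr0n addr0; congr (_ * _)%E; apply: eq_integral => u _.
by rewrite /vmul /dil /= !mul0r subr0 add0r ![_ + y.1]addrC ![_ + y.2]addrC.
Qed.

Lemma poisson_scale (e t : R) : 0 < e -> e * poisson e (e * t) = poisson 1 t.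
Proof.
move=> e0; have en0 := lt0r_neq0 e0.
have h : 1 + t ^+ 2 != 0 by rewrite lt0r_neq0// ltr_pwDl// sqr_ge0.
rewrite /poisson (_ : e ^+ 2 + _ = e ^+ 2 * (1 + t ^+ 2)); last by ring.
by rewrite expr1n; field; rewrite h en0.
Qed.

Lemma poisson2_dil e y u : 0 < e ->
  e ^+ 2 * poisson2 e (vsub (dil e y u) y) = poisson2 1 u.
Proof.
move=> e0; rewrite /poisson2 -(poisson_scale u.1 e0) -(poisson_scale u.2 e0).
by rewrite /vsub /dil /= !(addrC _ (e * _)) !addrK; ring.
Qed.

Lemma cintegral_dil e y (f : R2 -> R[i]) : 0 < e -> cmeasurable_fun setT f ->
  cintegral mu2 setT (fun u => f (dil e y u)) =
  cintegral mu2 setT (fun x => (e ^- 2)%:C * f x).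
Proof.
move=> e0 mf; apply: (@cintegral_change_of_variables R _ _ _ _ mu2 mu2 (dil e y)
  (fun=> e ^- 2) set0) => //; first by move=> _; rewrite invr_ge0 sqr_ge0.
move=> h mh h0 _; rewrite ge0_integralZl//; last by rewrite lee_fin invr_ge0 sqr_ge0.
rewrite (@ge0_integral_dil e y h)// muleA -EFinM mulVf ?mul1e//.
by rewrite sqrf_eq0 gt_eqF.
Qed.

Lemma poisson2C e x y : poisson2 e (vsub x y) = poisson2 e (vsub y x).
Proof.
by rewrite /poisson2 /poisson /vsub /= -(sqrrN (x.1 - _)) -(sqrrN (x.2 - _)) !opprB.
Qed.

Lemma measurable_poisson2_vsub e d (S : measurableType d) (f g : S -> R2) :
  measurable_fun setT f -> measurable_fun setT g ->
  measurable_fun setT (fun s => poisson2 e (vsub (f s) (g s))).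
Proof.
move=> mf mg; apply: (measurableT_comp (@measurable_poisson2 e)).
exact: measurable_vsub.
Qed.

Lemma integral_poisson2_vsub e y : 0 < e ->
  (\int[mu2]_x (poisson2 e (vsub x y))%:E = ((2 * pi) ^+ 2)%:E)%E.
Proof.
move=> e0; rewrite (@ge0_integral_dil e y)//; last 2 first.
- by apply/measurable_EFinP; exact: measurable_poisson2_vsub.
- by move=> x; rewrite lee_fin poisson2_ge0.
rewrite -ge0_integralZl//; last 3 first.
- apply/measurable_EFinP; apply: measurable_poisson2_vsub => //.
  exact: measurable_dil.
- by move=> x _; rewrite lee_fin poisson2_ge0.
- by rewrite lee_fin sqr_ge0.
under eq_integral do rewrite -EFinM poisson2_dil//.
exact: integral_poisson2.
Qed.

Lemma cvg_abel2_harmonic p : abel2 n.+1%:R^-1 p @[n --> \oo] --> (1 : R).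
Proof.
have ct (t : R) : abel n.+1%:R^-1 t @[n --> \oo] --> (1 : R).
  rewrite [X in _ --> X](_ : 1 = expR (- 0 * `|t|)); last first.
    by rewrite oppr0 mul0r expR0.
  apply: continuous_cvg; first exact: continuous_expR.
  by apply: cvgMr_tmp; apply: cvgN; exact: cvg_harmonic.
have := cvgM (ct p.1) (ct p.2); by rewrite mulr1; apply.
Qed.

(** Schur's test: |a(x) a(y)| <= (|a(x)|^2 + |a(y)|^2) / 2, and the symmetric kernel has mass (2
    pi)^2 in each variable. *)
Lemma regularized_bessel a e : 0 < e -> cintegrable mu2 setT a ->
  (\int[mu2]_p (abel2 e p * normc (FT a p) ^+ 2)%:E <=
   ((2 * pi) ^+ 2)%:E * \int[mu2]_x (normc (a x) ^+ 2)%:E)%E.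
Proof.
move=> e0 ia.
have ma := cintegrable_measurable measurableT ia.
have [M aM] := FT_bounded ia.
have mna := measurable_normc ma.
have ms : measurable_fun setT (fun x => normc (a x) ^+ 2) by exact: measurable_funX.
have iF : cintegrable mu2 setT (fun p => (abel2 e p)%:C * (FT a p * (FT a p)^*)).
  under eq_fun do rewrite mulrC.
  apply: (@cintegrable_boundM _ _ _ mu2 setT measurableT _ _ (M * M)).
  - exact: cintegrable_abel2.
  - apply: cmeasurableM; first exact: cmeasurable_FT.
    by apply: cmeasurable_conj; exact: cmeasurable_FT.
  - by move=> p _; rewrite normcM normc_conj ler_pM ?normc_ge0.
have EF p : (abel2 e p)%:C * (FT a p * (FT a p)^*) =
    (abel2 e p * normc (FT a p) ^+ 2)%:C.
  by rewrite (mulrC (FT a p)) conj_mulc -realcM.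
(* Boundedness of the transform makes this integral finite, so it may be read as the complex
   integral of the regularized identity. *)
have -> : (\int[mu2]_p (abel2 e p * normc (FT a p) ^+ 2)%:E)%E =
   (complex.Re (cintegral mu2 setT (fun p => (abel2 e p)%:C * (FT a p * (FT a p)^*))))%:E.
  under eq_cintegral do rewrite EF.
  rewrite cintegral_real /= /Rintegral fineK//.
  apply: integrable_fin_num => //; have [iFr _] := iF.
  by apply: eq_integrable iFr => // p _; rewrite EF.
rewrite regularized_parseval//.
pose f (z : R2 * R2) : R[i] := (poisson2 e (vsub z.1 z.2))%:C * (a z.1 * (a z.2)^*).
have fi : cintegrable (mu2 \x mu2)%E setT f.
  apply: (@cintegrable_tensor_plane R (fun z => (poisson2 e (vsub z.1 z.2))%:C) a
    (fun y => (a y)^*) ((2 / e) ^+ 2)) => //.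
  - by apply: cmeasurable_real; exact: measurable_poisson2_vsub.
  - by move=> z; rewrite normc_real ger0_norm ?poisson2_ge0// poisson2_le.
  - exact: cintegrable_conj.
have mf := cintegrable_measurable measurableT fi.
rewrite (cintegral12 fi) (le_trans (Re_cintegral_le _ measurableT mf))//.
apply: (@le_trans _ _ (\int[mu2]_x \int[mu2]_y (normc (f (x, y)))%:E)%E).
  rewrite (@ge0_tonelli_plane R (fun z => (normc (f z))%:E))//.
    by apply/measurable_EFinP; exact: measurable_normc.
  by move=> x; rewrite lee_fin normc_ge0.
pose g1 (z : R2 * R2) := (poisson2 e (vsub z.1 z.2) * (normc (a z.1) ^+ 2 / 2))%:E.
pose g2 (z : R2 * R2) := (poisson2 e (vsub z.1 z.2) * (normc (a z.2) ^+ 2 / 2))%:E.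
have mg1 : measurable_fun setT g1.
  apply/measurable_EFinP/measurable_funM; first exact: measurable_poisson2_vsub.
  by apply: measurable_funM => //; exact: (measurableT_comp ms).
have mg2 : measurable_fun setT g2.
  apply/measurable_EFinP/measurable_funM; first exact: measurable_poisson2_vsub.
  by apply: measurable_funM => //; exact: (measurableT_comp ms).
have g10 z : (0 <= g1 z)%E.
  by rewrite lee_fin mulr_ge0 ?poisson2_ge0// divr_ge0// sqr_ge0.
have g20 z : (0 <= g2 z)%E.
  by rewrite lee_fin mulr_ge0 ?poisson2_ge0// divr_ge0// sqr_ge0.
have mfg h : measurable_fun setT h -> (forall z, (0 <= h z)%E) ->
    measurable_fun setT (fun x : R2 => \int[mu2]_y h (x, y))%E.
  by move=> mh h0; exact: (@measurable_fun_fubini_tonelli_F _ _ _ _ _ mu2 h mh h0).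
apply: (@le_trans _ _ (\int[mu2]_x (\int[mu2]_y g1 (x, y) + \int[mu2]_y g2 (x, y)))%E).
  apply: ge0_le_integral => //.
  - by move=> x _; apply: integral_ge0 => y _; rewrite lee_fin normc_ge0.
  - apply: (mfg (fun z => (normc (f z))%:E)).
      by apply/measurable_EFinP; exact: measurable_normc.
    by move=> z; rewrite lee_fin normc_ge0.
  - by apply: emeasurable_funD; apply: mfg.
  - move=> x _; rewrite -ge0_integralD//; last 2 first.
    + exact: (measurableT_comp mg1).
    + exact: (measurableT_comp mg2).
    apply: ge0_le_integral => //.
    + by move=> y _; rewrite lee_fin normc_ge0.
    + apply/measurable_EFinP; apply: (measurableT_comp (measurable_normc mf)).
      exact: measurable_fun_pair.
    + by apply: emeasurable_funD; [exact: (measurableT_comp mg1)|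
         exact: (measurableT_comp mg2)].
    + move=> y _; rewrite -EFinD lee_fin /f /= !normcM normc_conj normc_real.
      rewrite ger0_norm ?poisson2_ge0// -mulrDr ler_wpM2l ?poisson2_ge0//.
      rewrite -mulrDl ler_pdivlMr// -subr_ge0.
      rewrite (_ : _ - _ = (normc (a x) - normc (a y)) ^+ 2) ?sqr_ge0//.
      by ring.
rewrite ge0_integralD//; last 4 first.
- by move=> x _; apply: integral_ge0.
- exact: mfg.
- by move=> x _; apply: integral_ge0.
- exact: mfg.
rewrite (ge0_fubini_plane mg2 g20).
(* Integrating out the kernel; each of [g1] and [g2] thus contributes half of the bound. *)
have half (x : R2) : (\int[mu2]_y (poisson2 e (vsub y x) * (normc (a x) ^+ 2 / 2))%:E =
    (((2 * pi) ^+ 2) * (normc (a x) ^+ 2 / 2))%:E)%E.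
  under eq_integral do rewrite EFinM.
  rewrite ge0_integralZr//; last 3 first.
  - by apply/measurable_EFinP; exact: measurable_poisson2_vsub.
  - by move=> y _; rewrite lee_fin poisson2_ge0.
  - by rewrite lee_fin divr_ge0// sqr_ge0.
  by rewrite integral_poisson2_vsub.
under eq_integral => x _.
  under eq_integral do rewrite /g1 /= poisson2C.
  rewrite half.
  over.
under [X in (_ + X)%E]eq_integral do rewrite half.
rewrite -ge0_integralD//; last 4 first.
- by move=> x _; rewrite lee_fin mulr_ge0 ?sqr_ge0// divr_ge0// sqr_ge0.
- by apply/measurable_EFinP/measurable_funM => //; exact: measurable_funM.
- by move=> x _; rewrite lee_fin mulr_ge0 ?sqr_ge0// divr_ge0// sqr_ge0.
- by apply/measurable_EFinP/measurable_funM => //; exact: measurable_funM.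
rewrite -ge0_integralZl//; last 3 first.
- exact/measurable_EFinP.
- by move=> x _; rewrite lee_fin sqr_ge0.
- by rewrite lee_fin sqr_ge0.
rewrite le_eqVlt; apply/orP; left; apply/eqP; apply: eq_integral => x _.
by rewrite -EFinD -EFinM; congr EFin; field.
Qed.

(** Monotone convergence as the Abel weights at e = 1 / (n + 1) increase to 1, the bound being the
    same for all of them. *)
Lemma bessel a : cintegrable mu2 setT a ->
  (\int[mu2]_p (normc (FT a p) ^+ 2)%:E <=
   ((2 * pi) ^+ 2)%:E * \int[mu2]_x (normc (a x) ^+ 2)%:E)%E.
Proof.
move=> ia; have ma := cintegrable_measurable measurableT ia.
have mF : measurable_fun setT (fun p => normc (FT a p) ^+ 2).
  by apply: measurable_funX; apply: measurable_normc; exact: cmeasurable_FT.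
pose g n p := (abel2 n.+1%:R^-1 p * normc (FT a p) ^+ 2)%:E.
have gcvg p : g n p @[n --> \oo] --> (normc (FT a p) ^+ 2)%:E.
  apply: cvg_EFin; first exact: nearW.
  rewrite -[X in _ --> X]mul1r; apply: cvgMr_tmp; exact: cvg_abel2_harmonic.
have := @cvg_monotone_convergence _ _ R mu2 setT measurableT g.
have -> : (fun x => limn (g ^~ x)) = (fun p => (normc (FT a p) ^+ 2)%:E).
  by apply/funext => p; apply/cvg_lim => //; exact: gcvg.
move=> h; have {}h : (\int[mu2]_p g n p)%E @[n --> \oo] -->
    (\int[mu2]_p (normc (FT a p) ^+ 2)%:E)%E.
  apply: h.
  - move=> n; apply/measurable_EFinP/measurable_funM => //.
    exact: measurable_abel2.
  - by move=> n p _; rewrite lee_fin mulr_ge0 ?abel2_ge0// sqr_ge0.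
  - move=> p _ m n mn; rewrite lee_fin ler_wpM2r ?sqr_ge0//.
    have le t : abel m.+1%:R^-1 t <= abel n.+1%:R^-1 t.
      rewrite ler_expR !mulNr lerN2 ler_wpM2r// lef_pV2 ?posrE// ler_nat ltnS.
      exact: mn.
    by rewrite /abel2 ler_pM ?abel_ge0 ?le.
apply: (cvge_to_le h).
by apply: nearW => n; exact: regularized_bessel.
Qed.

(** On the side of the transforms the Abel weight is removed by domination; on the other side the
    kernels average the continuous bounded [a] near [y] and converge to a multiple of a(y), whereas
    [b] is only integrated against. *)
Lemma parseval a b (M : R) :
  continuous (fun x : R2 => complex.Re (a x)) ->
  continuous (fun x : R2 => complex.Im (a x)) ->
  (forall x, normc (a x) <= M) ->
  cintegrable mu2 setT a -> cintegrable mu2 setT b ->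
  cintegrable mu2 setT (fun p => FT a p * (FT b p)^*) ->
  cintegral mu2 setT (fun p => FT a p * (FT b p)^*) =
  ((2 * pi) ^+ 2)%:C * cintegral mu2 setT (fun x => a x * (b x)^*).
Proof.
move=> car cai aM ia ib iab.
have ma := cintegrable_measurable measurableT ia.
have mb := cintegrable_measurable measurableT ib.
have e0 n : (0 : R) < n.+1%:R^-1 by rewrite invr_gt0.
pose u n := cintegral mu2 setT (fun p => (abel2 n.+1%:R^-1 p)%:C * (FT a p * (FT b p)^*)).
have c1 : ccvg u (cintegral mu2 setT (fun p => FT a p * (FT b p)^*)).
  apply: (@dominated_ccvg _ _ _ mu2 _ _ (fun p => normc (FT a p * (FT b p)^*))).
  - move=> n; apply: cmeasurableM.
      by apply: cmeasurable_real; exact: measurable_abel2.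
    exact: (cintegrable_measurable measurableT iab).
  - move=> p; rewrite -[X in ccvg _ X]mul1r; apply: ccvgM; last exact: ccvg_cst.
    by apply: ccvg_real; exact: cvg_abel2_harmonic.
  - by have [] := (cintegrableP mu2 measurableT _).1 iab.
  - move=> n p; rewrite normcM normc_real ger0_norm ?abel2_ge0//.
    by rewrite ler_piMl ?normc_ge0// abel2_le1// ltW.
apply: (ccvg_unique c1).
(* The average of [a] around [y] at scale 1 / (n + 1), written with the fixed kernel. *)
pose J n y := cintegral mu2 setT (fun v => a (dil n.+1%:R^-1 y v) * (poisson2 1 v)%:C).
have uE n : u n = cintegral mu2 setT (fun y => (b y)^* * J n y).
  rewrite /u /J regularized_parseval//.
  move: (e0 n); set e := n.+1%:R^-1 => en0.
  have mP : cmeasurable_fun setT (fun z : R2 * R2 => (poisson2 e (vsub z.1 z.2))%:C).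
    by apply: cmeasurable_real; exact: measurable_poisson2_vsub.
  have nP (z : R2) : normc (poisson2 e z)%:C <= (2 / e) ^+ 2.
    by rewrite normc_real ger0_norm ?poisson2_ge0//; apply: poisson2_le.
  rewrite (cintegral_swap_plane (f := fun z => (poisson2 e (vsub z.1 z.2))%:C *
    (a z.1 * (b z.2)^*))); last first.
    apply: (@cintegrable_tensor_plane R (fun z => (poisson2 e (vsub z.1 z.2))%:C) a
      (fun y => (b y)^*) ((2 / e) ^+ 2)) => //.
    exact: cintegrable_conj.
  apply: eq_cintegral => y _ /=.
  have iPa : cintegrable mu2 setT (fun x => (poisson2 e (vsub x y))%:C * a x).
    apply: (@cintegrable_boundM _ _ _ mu2 setT measurableT _ _ ((2 / e) ^+ 2)) => //.
    by apply: cmeasurable_real; exact: measurable_poisson2_vsub.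
  transitivity (cintegral mu2 setT (fun x => (b y)^* * ((poisson2 e (vsub x y))%:C * a x))).
    by apply: eq_cintegral => x _; ring.
  rewrite cintegralZ//; congr (_ * _).
  (* The factor e^2 turns the dilated kernel into the one at scale 1 and is compensated by the
     Jacobian e^-2. *)
  transitivity (cintegral mu2 setT (fun v => (e ^+ 2 *
      poisson2 e (vsub (dil e y v) y))%:C * a (dil e y v))); last first.
    by apply: eq_cintegral => v _; rewrite poisson2_dil// mulrC.
  rewrite (@cintegral_dil e y (fun x => (e ^+ 2 * poisson2 e (vsub x y))%:C * a x))//.
    apply: eq_cintegral => x _; rewrite mulrA -realcM mulrA mulVf ?mul1r//.
    by rewrite sqrf_eq0 gt_eqF.
  apply: cmeasurableM => //; apply: cmeasurable_real; apply: measurable_funM => //.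
  exact: measurable_poisson2_vsub.
have -> : u = (fun n => cintegral mu2 setT (fun y => (b y)^* * J n y)).
  by apply/funext.
have mP1 : cmeasurable_fun setT (fun v : R2 => (poisson2 1 v)%:C).
  by apply: cmeasurable_real; exact: measurable_poisson2.
have iP1 : cintegrable mu2 setT (fun v => (poisson2 1 v)%:C).
  apply: cintegrable_lty => //.
  under eq_integral do rewrite normc_real ger0_norm ?poisson2_ge0//.
  by rewrite integral_poisson2 ltry.
have M0 : 0 <= M by apply: le_trans (aM (0, 0)); exact: normc_ge0.
have iMP : mu2.-integrable setT (fun v => (M * poisson2 1 v)%:E).
  have [i1 _] := iP1; by have := integrableZl measurableT M i1.
have mdil n : cmeasurable_fun setT (fun z : R2 * R2 => a (dil n.+1%:R^-1 z.1 z.2)).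
  by apply: cmeasurable_comp => //; exact: measurable_dil.
have nJ n y v : normc (a (dil n.+1%:R^-1 y v) * (poisson2 1 v)%:C) <= M * poisson2 1 v.
  by rewrite normcM normc_real ger0_norm ?poisson2_ge0// ler_wpM2r ?poisson2_ge0.
have mJ' n y : cmeasurable_fun setT (fun v => a (dil n.+1%:R^-1 y v) * (poisson2 1 v)%:C).
  by apply: cmeasurableM => //; apply: cmeasurable_comp => //; exact: measurable_dil.
have Jcvg y : ccvg (J ^~ y) (((2 * pi) ^+ 2)%:C * a y).
  have -> : ((2 * pi) ^+ 2)%:C * a y = cintegral mu2 setT (fun v => a y * (poisson2 1 v)%:C).
    rewrite cintegralZ// cintegral_real /Rintegral integral_poisson2 mulrC//.
  apply: (@dominated_ccvg _ _ _ mu2 _ _ (fun v => M * poisson2 1 v)) => //;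
    first by move=> n; exact: mJ'.
  move=> v.
  apply: (@ccvgM _ (fun n => a (dil n.+1%:R^-1 y v)) (fun=> (poisson2 1 v)%:C));
    last exact: ccvg_cst.
  have cd : dil n.+1%:R^-1 y v @[n --> \oo] --> y.
    exact: cvg_dil.
  split.
  - exact: (cvg_comp _ _ cd (car y)).
  - exact: (cvg_comp _ _ cd (cai y)).
rewrite -cintegralZ//; last first.
  apply: (@cintegrable_boundM _ _ _ mu2 setT measurableT _ _ M) => //.
  exact: cintegrable_conj.
(* The dominating constant is the bound of [a] times the mass of the kernel, doubled by
   [normc_cintegral_le]. *)
apply: (@dominated_ccvg _ _ _ mu2 _ _
  (fun y => normc (b y) * (2 * (M * (2 * pi) ^+ 2)))).
- move=> n; apply: cmeasurableM; first exact: cmeasurable_conj.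
  apply: (@cmeasurable_cintegral_plane R (fun z => a (dil n.+1%:R^-1 z.1 z.2) *
     (poisson2 1 z.2)%:C)).
  apply: cmeasurableM; first exact: mdil.
  exact: (cmeasurable_comp mP1 measurable_snd).
- move=> y; rewrite (_ : _ * (_ * _) = (b y)^* * (((2 * pi) ^+ 2)%:C * a y)); last by ring.
  by apply: ccvgM => //; exact: ccvg_cst.
- have [_ i2] := (cintegrableP mu2 measurableT _).1 ib.
  by have := integrableZr measurableT (2 * (M * (2 * pi) ^+ 2)) i2.
- move=> n y; rewrite normcM normc_conj ler_wpM2l ?normc_ge0//.
  have iJ : cintegrable mu2 setT (fun v => a (dil n.+1%:R^-1 y v) * (poisson2 1 v)%:C).
    apply: (@le_cintegrable _ _ _ mu2 _ measurableT _ (fun v => M * poisson2 1 v)) => //.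
    exact: mJ'.
  rewrite (le_trans (normc_cintegral_le measurableT iJ))// ler_pM2l//.
  rewrite (_ : M * _ = Rintegral mu2 setT (fun v => M * poisson2 1 v)).
    by apply: le_Rintegral => //; have [] := (cintegrableP mu2 measurableT _).1 iJ.
  have [i1 _] := iP1.
  by rewrite RintegralZl// /Rintegral integral_poisson2.
Qed.

End FourierTransform.

(** * Test functions and square-integrable functions *)

Section TestFunctions.
Variable R : realType.
Local Notation R2 := (R * R)%type.
Local Notation mu2 := (@lebesgue2 R).

(* [f] is the pointwise limit of its composites with the grid projections
   [t |-> floor (n t) / n], which take countably many values. *)
Lemma continuous_plane_measurable (f : R2 -> R) :
  continuous f -> measurable_fun setT f.
Proof.
move=> cf.
pose r n (t : R) : R := (Num.floor (n.+1%:R * t))%:~R / n.+1%:R.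
have rt (t : R) : r n t @[n --> \oo] --> t.
  apply: (@squeeze_cvgr _ _ _ _ (fun n => t - n.+1%:R^-1) (fun=> t)).
  - apply: nearW => n; rewrite /r.
    have n0 : (0 : R) < n.+1%:R by [].
    have /andP[h1 h2] := real_floor_itv (num_real (n.+1%:R * t)).
    rewrite ler_pdivrMr// (mulrC t) h1 andbT.
    rewrite ler_pdivlMr// mulrBl mulVf ?gt_eqF// lerBlDr mulrC.
    by rewrite intrD1 in h2; exact: ltW.
  - rewrite [X in _ --> X](_ : t = t - 0); last by rewrite subr0.
    by apply: cvgB; [exact: cvg_cst|exact: cvg_harmonic].
  - exact: cvg_cst.
apply: (@measurable_fun_cvg _ _ _ _ (fun n x => f (r n x.1, r n x.2))).
  move=> n _ Y mY; rewrite setTI.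
  have -> : (fun x : R2 => f (r n x.1, r n x.2)) @^-1` Y =
    \bigcup_(k : int * int) (if `[< Y (f (k.1%:~R / n.+1%:R, k.2%:~R / n.+1%:R)) >]
      then [set t : R | Num.floor (n.+1%:R * t) = k.1] `*`
           [set t : R | Num.floor (n.+1%:R * t) = k.2] else set0).
    apply/seteqP; split => [[x y] /= Yxy|[x y] /= [k _]].
      exists (Num.floor (n.+1%:R * x), Num.floor (n.+1%:R * y)) => //=.
      by rewrite asboolT.
    by case: ifPn => // /asboolP Yk [/= hx hy]; rewrite /r hx hy.
  apply: countable_bigcupT_measurable => // k; case: ifPn => // _.
  have mfl (i : int) : measurable [set t : R | Num.floor (n.+1%:R * t) = i].
    rewrite (_ : [set t | _] = (fun t : R => n.+1%:R * t) @^-1` `[i%:~R, (i + 1)%:~R[).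
      rewrite -[X in measurable X]setTI; exact: mulrl_measurable.
    apply/seteqP; split => t /=; rewrite in_itv /=.
      by move=> <-; exact: (real_floor_itv (num_real _)).
    by move=> /floor_def.
  exact: measurableX.
move=> [x y] _ /=.
exact: (cvg_comp _ _ (cvg_pair (rt x) (rt y)) (cf (x, y))).
Qed.

Lemma measurable_R2star : measurable (@R2star R).
Proof.
rewrite (_ : @R2star R = ~` ([set 0%R] `*` [set 0%R])).
  by apply: measurableC; apply: measurableX.
apply/seteqP; split => -[x y] /=.
  by move=> /eqP h [/= hx hy]; apply: h; rewrite hx hy.
by move=> h; apply/eqP => -[x0 y0]; apply: h; rewrite x0 y0.
Qed.

Lemma test_function_continuous (f : R2 -> R[i]) : test_function f ->
  continuous (fun x : R2 => complex.Re (f x)) /\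
  continuous (fun x : R2 => complex.Im (f x)).
Proof. by move=> [fr fi _ _]; split; [exact: fr 0|exact: fi 0]. Qed.

Lemma test_function_measurable (f : R2 -> R[i]) : test_function f ->
  cmeasurable_fun setT f.
Proof.
by move=> /test_function_continuous[fr fi]; split; exact: continuous_plane_measurable.
Qed.

Lemma test_function0 (f : R2 -> R[i]) : test_function f -> f (0, 0) = 0.
Proof.
move=> [_ _ _ f0]; apply/eqP; apply: contraT => fn0.
by have := f0 _ (@subset_closure _ [set x | f x != 0] _ fn0); rewrite /R2star /= eqxx.
Qed.

(** Continuous functions are bounded on the compact support: the two components for the values, the
    two coordinates for the location. One constant serves all four. *)
Lemma test_function_bounded (f : R2 -> R[i]) : test_function f ->
  exists2 M : R, 0 <= M & forall x, normc (f x) <= M /\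
    (f x != 0 -> `|x.1| <= M /\ `|x.2| <= M).
Proof.
move=> tf; have [cr ci] := test_function_continuous tf; have [_ _ cK _] := tf.
set K := closure _ in cK.
have bK (h : R2 -> R) : continuous h -> exists N, forall x, K x -> `|h x| <= N.
  move=> ch.
  have /compact_bounded : compact (h @` K).
    by apply: continuous_compact => //; exact: continuous_subspaceT.
  move=> [N [_ hN]]; exists (N + 1) => x Kx.
  by apply: (hN (N + 1)); [rewrite ltrDl|exists x].
have [N1 h1] := bK _ cr; have [N2 h2] := bK _ ci.
have [N3 h3] := bK fst (fun x => cvg_fst).
have [N4 h4] := bK snd (fun x => cvg_snd).
exists (`|N1| + `|N2| + `|N3| + `|N4|); first by rewrite !addr_ge0.
move=> x.
have [->|fx] := eqVneq (f x) 0; first by rewrite normc0 !addr_ge0// eqxx.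
have Kx : K x by apply: subset_closure.
have le N : N <= `|N| :> R by exact: ler_norm.
have := h1 _ Kx; have := h2 _ Kx; have := h3 _ Kx; have := h4 _ Kx.
have := normc_le_ReIm (f x).
have := normr_ge0 N1; have := normr_ge0 N2; have := normr_ge0 N3; have := normr_ge0 N4.
have := le N1; have := le N2; have := le N3; have := le N4.
by move=> *; split=> [|_]; [lra|split; lra].
Qed.

(** Domination by a constant on the square of side 2 M, where |x| <= |x.1| + |x.2| <= 2 M. *)
Lemma test_function_integral_lty (f : R2 -> R[i]) k : test_function f ->
  (\int[mu2]_x (normc (f x) ^+ 2 * enorm x ^+ k)%:E < +oo)%E.
Proof.
move=> tf; have [M M0 fM] := test_function_bounded tf.
pose B : set R2 := `[- M, M]%classic `*` `[- M, M]%classic.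
have mB : measurable B by apply: measurableX.
have mf := test_function_measurable tf.
apply: (@le_lt_trans _ _ (\int[mu2]_x ((M ^+ 2 * (M + M) ^+ k)%:E * (\1_B x)%:E))%E).
  apply: ge0_le_integral => //.
  - by move=> x _; rewrite lee_fin mulr_ge0 ?exprn_ge0 ?normc_ge0 ?enorm_ge0.
  - apply/measurable_EFinP/measurable_funM; apply: measurable_funX.
      exact: measurable_normc.
    exact: measurable_enorm.
  - by apply/measurable_EFinP/measurable_funM => //; exact: measurable_indic.
  - move=> x _; rewrite -EFinM lee_fin.
    have [->|fx] := eqVneq (f x) 0.
      by rewrite normc0 expr0n mul0r mulr_ge0// mulr_ge0 ?exprn_ge0 ?addr_ge0.
    have [nM /(_ fx) [x1 x2]] := fM x.
    have Bx : B x by split; rewrite /= in_itv /= -ler_norml.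
    rewrite indicE mem_set// mulr1 ler_pM ?exprn_ge0 ?normc_ge0 ?enorm_ge0//.
      by rewrite lerXn2r ?nnegrE ?normc_ge0.
    rewrite lerXn2r ?nnegrE ?enorm_ge0 ?addr_ge0//.
    by rewrite (le_trans (normc_le_ReIm _))// lerD.
rewrite ge0_integralZl//; last 2 first.
- by apply/measurable_EFinP; exact: measurable_indic.
- by rewrite lee_fin mulr_ge0 ?exprn_ge0 ?addr_ge0.
rewrite integral_indic// setIT.
apply: lte_mul_pinfty => //; first by rewrite lee_fin mulr_ge0 ?exprn_ge0 ?addr_ge0.
rewrite [X in (X < _)%E](_ : _ = (lebesgue_measure `[(- M)%R, M]%classic *
  lebesgue_measure `[(- M)%R, M]%classic)%E); last exact: product_measure1E.
rewrite lebesgue_measure_itv /=; case: ifP => _; last by rewrite mule0 ltry.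
by rewrite -EFinD -EFinM ltry.
Qed.

End TestFunctions.

(** * Square-integrable functions under dilations *)

Section SquareIntegrable.
Variable R : realType.
Local Notation R2 := (R * R)%type.
Local Notation mu2 := (@lebesgue2 R).
Implicit Types u v : R2 -> R[i].

Lemma L2_zero_ext u : L2 u -> cmeasurable_fun setT (zero_ext (@R2star R) u) /\
  (\int[mu2]_x (normc (zero_ext (@R2star R) u x) ^+ 2)%:E < +oo)%E.
Proof.
move=> [mu]; rewrite integral_mkcond => uoo; split.
  exact: (cmeasurable_zero_ext (@measurable_R2star R)).
move: uoo; rewrite (_ : _ \_ _ = fun x => (normc (zero_ext (@R2star R) u x) ^+ 2)%:E)//.
apply/funext => x; rewrite patchE /zero_ext; case: ifPn => // _.
by rewrite normc0 expr0n.
Qed.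

Lemma vdiv_neq0 (x q : R2) : x != (0, 0) -> q != (0, 0) -> vdiv x q != (0, 0).
Proof.
by move=> x0 q0; rewrite -enorm_eq0 enorm_vdiv mulf_neq0 ?invr_neq0 ?enorm_eq0.
Qed.

Lemma integral_vdiv_lty (q : R2) u : q != (0, 0) -> cmeasurable_fun setT u ->
  (\int[mu2]_x (normc (u x) ^+ 2)%:E < +oo)%E ->
  (\int[mu2]_x (normc (u (vdiv x q)) ^+ 2)%:E < +oo)%E.
Proof.
move=> q0 mu uoo.
rewrite (@ge0_integral_vmul _ (fun x => (normc (u (vdiv x q)) ^+ 2)%:E) q)//.
- under eq_integral do rewrite vdiv_vmul//.
  by apply: lte_mul_pinfty => //; rewrite lee_fin sqr_ge0.
- apply/measurable_EFinP/measurable_funX/measurable_normc.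
  by apply: cmeasurable_comp => //; exact: measurable_vdiv.
- by move=> x; rewrite lee_fin sqr_ge0.
Qed.

(** The weight depends on |q| only, which is |x| / |y| when y = x/q. This is the form in which all
    absolute convergence is checked. *)
Lemma ge0_integral_weighted_dilation (w : R -> R) (u v : R2 -> R) :
  measurable_fun setT w -> measurable_fun setT u -> measurable_fun setT v ->
  (forall t, 0 <= w t) -> (forall x, 0 <= u x) -> (forall x, 0 <= v x) ->
  u (0, 0) = 0 -> v (0, 0) = 0 ->
  (\int[mu2]_q \int[mu2]_x (w (enorm q) * (u x * v (vdiv x q)))%:E =
  \int[mu2]_y \int[mu2]_x (enorm x ^+ 2 / enorm y ^+ 4 *
     (w (enorm x / enorm y) * (u x * v y)))%:E)%E.
Proof.
move=> mw mu mv w0 u0 v0 uz vz.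
pose G (z : R2 * R2) := (w (enorm z.1 / enorm z.2) * (u z.1 * v z.2))%:E.
have mG : measurable_fun setT G.
  apply/measurable_EFinP/measurable_funM.
    apply: (measurableT_comp mw); apply: measurable_funM.
      exact: measurable_enorm.
    by apply: (measurableT_comp (@measurable_inv R)); exact: measurable_enorm.
  by apply: measurable_funM; [exact: (measurableT_comp mu)|exact: (measurableT_comp mv)].
transitivity (\int[mu2]_q \int[mu2]_x G (x, vdiv x q))%E.
  apply: eq_integral => q _; apply: eq_integral => x _; rewrite /G /=.
  (* At x = 0 the quotient |x| / |x/q| no longer recovers |q|, but [u] vanishes. *)
  have [->|x0] := eqVneq x (0, 0); first by rewrite uz !mul0r !mulr0.
  rewrite enorm_vdiv invf_div.
  by rewrite (mulrCA (enorm x)) divff ?mulr1// enorm_eq0.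
rewrite ge0_integral_dilation//.
- by move=> z; rewrite lee_fin mulr_ge0// mulr_ge0.
- by move=> x; rewrite /G /= vz !mulr0.
Qed.

Lemma ge0_integral_tensor_lty (u v : R2 -> R) :
  measurable_fun setT u -> measurable_fun setT v ->
  (forall x, 0 <= u x) -> (forall x, 0 <= v x) ->
  (\int[mu2]_x (u x)%:E < +oo -> \int[mu2]_x (v x)%:E < +oo ->
   \int[mu2]_y \int[mu2]_x (u x * v y)%:E < +oo)%E.
Proof.
move=> mu mv u0 v0 uoo voo.
under eq_integral => y _.
  under eq_integral do rewrite EFinM.
  rewrite ge0_integralZr//; last 3 first.
  - exact/measurable_EFinP.
  - by move=> x _; rewrite lee_fin.
  - by rewrite lee_fin.
  over.
rewrite ge0_integralZl//; last 3 first.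
- exact/measurable_EFinP.
- by move=> x _; rewrite lee_fin.
- by apply: integral_ge0 => x _; rewrite lee_fin.
apply: lte_mul_pinfty => //.
- by apply: integral_ge0 => x _; rewrite lee_fin.
- by rewrite ge0_fin_numE//; apply: integral_ge0 => x _; rewrite lee_fin.
Qed.

End SquareIntegrable.

(** * The weak integral *)

Section WeakIntegral.
Variable R : realType.
Local Notation R2 := (R * R)%type.
Local Notation mu2 := (@lebesgue2 R).
Variables (psi : R2 -> R[i]) (f g : R2 -> R[i]).
Hypothesis Lpsi : L2 psi.
Hypothesis apsi : admissible psi.
Hypothesis tf : test_function f.
Hypothesis tg : test_function g.

Let psi0 := zero_ext (@R2star R) psi.
(** Occurs inverted through the two factors of C^-1 and directly through Parseval's formula, where
    it cancels. *)
Let S : R := (2 * pi) ^+ 2.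

Let A (q x : R2) : R[i] := (f x)^* * (enorm x ^+ 2)%:C * g (vdiv x q).
Let B (q x : R2) : R[i] := (psi0 x)^* * psi0 (vdiv x q).

Let S_gt0 : 0 < S. Proof. by rewrite exprn_gt0// mulr_gt0// pi_gt0. Qed.

Let Sv_ge0 : 0 <= S^-1. Proof. by rewrite invr_ge0 ltW. Qed.

Let enormV_ge0 (q : R2) k : 0 <= enorm q ^- k.
Proof. by rewrite invr_ge0 exprn_ge0// enorm_ge0. Qed.

Let psi0E x : x != (0, 0) -> psi0 x = psi x.
Proof. by move=> x0; rewrite /psi0 /zero_ext mem_set. Qed.

Let psi00 : psi0 (0, 0) = 0.
Proof. by rewrite /psi0 /zero_ext memNset//= /R2star /= eqxx. Qed.

Let f0 : f (0, 0) = 0. Proof. exact: test_function0. Qed.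
Let g0 : g (0, 0) = 0. Proof. exact: test_function0. Qed.

Let mf : cmeasurable_fun setT f. Proof. exact: test_function_measurable. Qed.
Let mg : cmeasurable_fun setT g. Proof. exact: test_function_measurable. Qed.

Let mpsi0 : cmeasurable_fun setT psi0.
Proof. by have [] := L2_zero_ext Lpsi. Qed.

Let zero_extE (h : R2 -> R[i]) x : h (0, 0) = 0 -> zero_ext (@R2star R) h x = h x.
Proof.
move=> h0; rewrite /zero_ext; case: ifPn => // xN.
suff -> : x = (0, 0) by rewrite h0.
by apply/eqP; apply: contraNT xN => x0; rewrite inE.
Qed.

Let psi_L2 : (\int[mu2]_x (normc (psi0 x) ^+ 2)%:E < +oo)%E.
Proof. by have [] := L2_zero_ext Lpsi. Qed.

Let psi_adm : (\int[mu2]_x (normc (psi0 x) ^+ 2 / enorm x ^+ 2)%:E < +oo)%E.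
Proof.
move: apsi; rewrite /admissible integral_mkcond.
rewrite (_ : _ \_ _ = fun x => (normc (psi0 x) ^+ 2 / enorm x ^+ 2)%:E)//.
apply/funext => x; rewrite patchE /psi0 /zero_ext; case: ifPn => // _.
by rewrite normc0 expr0n mul0r.
Qed.

Let mA : cmeasurable_fun setT (fun z : R2 * R2 => A z.1 z.2).
Proof.
apply: cmeasurableM; first apply: cmeasurableM.
- by apply: cmeasurable_conj; exact: (cmeasurable_comp mf measurable_snd).
- by apply: cmeasurable_real; apply: measurable_funX; exact: measurable_enorm.
- by apply: (cmeasurable_comp mg); exact: measurable_vdiv.
Qed.

Let mB : cmeasurable_fun setT (fun z : R2 * R2 => B z.1 z.2).
Proof.
apply: cmeasurableM.
- by apply: cmeasurable_conj; exact: (cmeasurable_comp mpsi0 measurable_snd).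
- by apply: (cmeasurable_comp mpsi0); exact: measurable_vdiv.
Qed.

Let iA q : q != (0, 0) -> cintegrable mu2 setT (A q).
Proof.
move=> q0; apply: cintegrable_mul; first exact: measurableT.
- apply: cmeasurableM; first exact: cmeasurable_conj.
  by apply: cmeasurable_real; apply: measurable_funX; exact: measurable_enorm.
- by apply: (cmeasurable_comp mg); exact: measurable_vdiv.
- have := test_function_integral_lty 4 tf; apply: le_lt_trans.
  rewrite le_eqVlt; apply/orP; left; apply/eqP; apply: eq_integral => x _.
  by rewrite normcM normc_conj normc_real ger0_norm ?sqr_ge0// exprMn -exprM.
- apply: integral_vdiv_lty => //.
  have := test_function_integral_lty 0 tg; apply: le_lt_trans.
  by under [leRHS]eq_integral do rewrite expr0 mulr1.
Qed.

Let iB q : q != (0, 0) -> cintegrable mu2 setT (B q).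
Proof.
move=> q0; apply: cintegrable_mul; first exact: measurableT.
- exact: cmeasurable_conj.
- by apply: (cmeasurable_comp mpsi0); exact: measurable_vdiv.
- by under eq_integral do rewrite normc_conj.
- exact: integral_vdiv_lty.
Qed.

Let F (qp : R2 * R2) : R[i] :=
  braket f (CDM_inv (U qp.1 qp.2 (CDM_inv g))) * varpi psi qp.1 qp.2.

Let G (qp : R2 * R2) : R[i] :=
  (S^-1 * enorm qp.1 ^- 4)%:C * (FT (A qp.1) qp.2 * (FT (B qp.1) qp.2)^*).

Let braketE q p : q != (0, 0) ->
  braket f (CDM_inv (U q p (CDM_inv g))) = (S^-1 * enorm q ^- 2)%:C * FT (A q) p.
Proof.
move=> q0; rewrite /braket cintegral_mkcond /FT -cintegralZ//; last first.
  by apply: cintegrable_expi_mul; exact: iA.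
apply: eq_cintegral => x _; rewrite zero_extE; last first.
  by rewrite f0 rmorph0 mul0r.
rewrite /CDM_inv /U /A enorm_vdiv.
have nq0 : enorm q != 0 by rewrite enorm_eq0.
rewrite (_ : (S^-1 * enorm q ^- 2)%:C * (expi (dotp p x) *
   ((f x)^* * (enorm x ^+ 2)%:C * g (vdiv x q))) =
   (f x)^* * expi (dotp p x) * g (vdiv x q) *
   (S^-1 * enorm q ^- 2 * enorm x ^+ 2)%:C); last by rewrite !realcM; ring.
rewrite -(fmorphV (real_complex R)).
rewrite (_ : S^-1 * enorm q ^- 2 * enorm x ^+ 2 =
  enorm x / (2 * pi) * (enorm q)^-1 * (enorm x / enorm q / (2 * pi))); last first.
  move: (lt0r_neq0 (pi_gt0 R)); rewrite /S; generalize (pi : R) => P P0.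
  by field; rewrite ?P0 ?nq0.
by rewrite !realcM; ring.
Qed.

Let varpiE q p : q != (0, 0) ->
  varpi psi q p = (enorm q ^- 2)%:C * (FT (B q) p)^*.
Proof.
move=> q0; rewrite /varpi /braket cintegral_mkcond.
rewrite (_ : enorm q ^- 2 = (enorm q)^-1 * (enorm q)^-1); last first.
  by rewrite -exprVn expr2.
rewrite realcM -mulrA mulrC (fmorphV (real_complex R)); congr (_ * _).
have E : (FT (B q) p)^* = cintegral mu2 setT (fun x => (expi (dotp p x) * B q x)^*).
  by rewrite cintegral_conj//; apply: cintegrable_expi_mul; exact: iB.
transitivity ((enorm q)%:C^-1 * cintegral mu2 setT (fun x => (expi (dotp p x) * B q x)^*));
  last by rewrite -E.
rewrite -cintegralZ//; last first.
  by apply: cintegrable_conj => //; apply: cintegrable_expi_mul; exact: iB.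
apply: eq_cintegral => x _; rewrite /zero_ext /B; case: ifPn => [|xN].
  rewrite inE /R2star /= => x0.
  rewrite !psi0E//; last first.
    exact: vdiv_neq0.
  have qE : ((enorm q)%:C^-1)^* = (enorm q)%:C^-1.
    by rewrite -(fmorphV (real_complex R)) conjc_realc.
  rewrite /U !conjcM conjCK qE; ring.
rewrite (_ : x = (0, 0)); last by apply/eqP; apply: contraNT xN => x0; rewrite inE.
by rewrite psi00 !(rmorph0 (@conjc R), mul0r, mulr0).
Qed.

Let sqr0 : (0 : R) ^+ 2 = 0. Proof. by rewrite expr0n. Qed.

Let G0 p : G ((0, 0), p) = 0.
Proof.
rewrite /G [(_, p).1]/= enorm0 expr0n (_ : S^-1 / _ = 0) ?(rmorph0 (real_complex R)) ?mul0r//.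
by rewrite /= invr0 mulr0.
Qed.

(** Each of the two matrix elements contributes |q|^-2. At q = 0 both sides are 0, so the equality
    holds on the whole plane. *)
Let GE : F = G.
Proof.
apply/funext => -[q p].
have [->|q0] := eqVneq q (0, 0).
  by rewrite G0 /F /varpi enorm0 (rmorph0 (real_complex R)) invr0 !mulr0.
rewrite /F /G /=.
rewrite braketE// varpiE//.
rewrite (_ : S^-1 * enorm q ^- 4 = S^-1 * enorm q ^- 2 * enorm q ^- 2); last first.
  by field; rewrite enorm_eq0 q0 gt_eqF.
by rewrite !realcM; ring.
Qed.

(** Fubini over (q, p) requires joint measurability, so the pair is treated as the parameter of a
    partial integral. *)
Let mFT (h : R2 -> R2 -> R[i]) : cmeasurable_fun setT (fun z : R2 * R2 => h z.1 z.2) ->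
  cmeasurable_fun setT (fun z : R2 * R2 => FT (h z.1) z.2).
Proof.
move=> mh.
apply: (@cmeasurable_cintegral R _ _ _ _ mu2 (fun w : (R2 * R2) * R2 =>
  expi (dotp w.1.2 w.2) * h w.1.1 w.2)).
apply: cmeasurableM.
  by apply: cmeasurable_expi_dotp => //; exact: (measurableT_comp measurable_snd measurable_fst).
apply: (cmeasurable_comp (f := fun z : R2 * R2 => h z.1 z.2) (g := fun w : (R2 * R2) * R2 => (w.1.1, w.2))) => //.
by apply: measurable_fun_pair => //; exact: (measurableT_comp measurable_fst measurable_fst).
Qed.

Let mG : cmeasurable_fun setT G.
Proof.
apply: cmeasurableM.
  apply: cmeasurable_real; apply: measurable_funM => //.
  apply: (measurableT_comp (@measurable_inv R)); apply: measurable_funX.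
  exact: measurable_enorm.
by apply: cmeasurableM; [|apply: cmeasurable_conj]; exact: mFT.
Qed.

Let bessel_bound q :
  (\int[mu2]_p (normc (G (q, p)))%:E <=
   (2^-1)%:E * (\int[mu2]_x (enorm q ^- 6 *
       ((normc (f x) ^+ 2 * enorm x ^+ 4) * normc (g (vdiv x q)) ^+ 2))%:E +
     \int[mu2]_x (enorm q ^- 2 * (normc (psi0 x) ^+ 2 * normc (psi0 (vdiv x q)) ^+ 2))%:E))%E.
Proof.
have [->|q0] := eqVneq q (0, 0).
  rewrite [leLHS]integral0_eq; last first.
    by move=> p _; rewrite G0 normc0.
  rewrite mule_ge0// adde_ge0//; apply: integral_ge0 => x _; rewrite lee_fin.
    by rewrite mulr_ge0 ?invr_ge0 ?exprn_ge0 ?enorm_ge0// !mulr_ge0 ?exprn_ge0 ?normc_ge0 ?enorm_ge0.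
  by rewrite mulr_ge0 ?invr_ge0 ?exprn_ge0 ?enorm_ge0// mulr_ge0 ?exprn_ge0 ?normc_ge0.
have nq0 : enorm q != 0 by rewrite enorm_eq0.
have iAq := iA q0; have iBq := iB q0.
have mAq := cintegrable_measurable measurableT iAq.
have mBq := cintegrable_measurable measurableT iBq.
have mFA : measurable_fun setT (fun p => normc (FT (A q) p) ^+ 2).
  by apply: measurable_funX; apply: measurable_normc; exact: cmeasurable_FT.
have mFB : measurable_fun setT (fun p => normc (FT (B q) p) ^+ 2).
  by apply: measurable_funX; apply: measurable_normc; exact: cmeasurable_FT.
have c1 : 0 <= S^-1 * enorm q ^- 6 / 2.
  by rewrite divr_ge0// mulr_ge0.
have c2 : 0 <= S^-1 * enorm q ^- 2 / 2.
  by rewrite divr_ge0// mulr_ge0.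
apply: (@le_trans _ _ (\int[mu2]_p ((S^-1 * enorm q ^- 6 / 2 * normc (FT (A q) p) ^+ 2)%:E +
  (S^-1 * enorm q ^- 2 / 2 * normc (FT (B q) p) ^+ 2)%:E))%E).
  apply: ge0_le_integral => //.
  - by move=> p _; rewrite lee_fin normc_ge0.
  - apply/measurable_EFinP; apply: measurable_normc.
    by apply: (cmeasurable_comp mG); exact: measurable_fun_pair.
  - by apply: emeasurable_funD; apply/measurable_EFinP; exact: measurable_funM.
  - move=> p _; rewrite -EFinD lee_fin /G [(_, _).1]/= [(_, _).2]/=.
    rewrite !normcM normc_conj normc_real.
    rewrite ger0_norm; last first.
      by rewrite mulr_ge0.
    rewrite -subr_ge0.
    (* The difference of the two sides is a square with the weights |q|^-3 on FT A_q and |q|^-1 on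
       FT B_q. *)
    rewrite (_ : _ - _ = S^-1 / 2 * (enorm q ^- 3 * normc (FT (A q) p) -
       enorm q ^- 1 * normc (FT (B q) p)) ^+ 2); last first.
      by field; rewrite nq0 gt_eqF.
    by rewrite mulr_ge0 ?sqr_ge0// divr_ge0// invr_ge0 ltW.
rewrite ge0_integralD//; last 4 first.
- by move=> p _; rewrite lee_fin mulr_ge0// sqr_ge0.
- by apply/measurable_EFinP; exact: measurable_funM.
- by move=> p _; rewrite lee_fin mulr_ge0// sqr_ge0.
- by apply/measurable_EFinP; exact: measurable_funM.
under eq_integral do rewrite EFinM.
under [X in (_ + X)%E]eq_integral do rewrite EFinM.
rewrite ge0_integralZl//; last 2 first.
- exact/measurable_EFinP.
- by move=> p _; rewrite lee_fin sqr_ge0.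
rewrite ge0_integralZl//; last 2 first.
- exact/measurable_EFinP.
- by move=> p _; rewrite lee_fin sqr_ge0.
rewrite [leRHS]ge0_muleDr; last 2 first.
- apply: integral_ge0 => x _; rewrite lee_fin.
  by rewrite mulr_ge0 ?invr_ge0 ?exprn_ge0 ?enorm_ge0// !mulr_ge0 ?exprn_ge0 ?normc_ge0 ?enorm_ge0.
- apply: integral_ge0 => x _; rewrite lee_fin.
  by rewrite mulr_ge0 ?invr_ge0 ?exprn_ge0 ?enorm_ge0// mulr_ge0 ?exprn_ge0 ?normc_ge0.
have SK (k : nat) (I : \bar R) : ((S^-1 * enorm q ^- k / 2)%:E * (S%:E * I) =
    (2^-1)%:E * ((enorm q ^- k)%:E * I))%E.
  rewrite !muleA -!EFinM; congr (_%:E * _)%E.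
  by field; rewrite expf_neq0// gt_eqF.
have mA2 : measurable_fun setT (fun x => normc (A q x) ^+ 2).
  by apply: measurable_funX; exact: measurable_normc.
have mB2 : measurable_fun setT (fun x => normc (B q x) ^+ 2).
  by apply: measurable_funX; exact: measurable_normc.
apply: leeD.
- apply: (@le_trans _ _ ((S^-1 * enorm q ^- 6 / 2)%:E *
    (S%:E * \int[mu2]_x (normc (A q x) ^+ 2)%:E))%E).
    by apply: lee_wpmul2l => //; exact: bessel.
  rewrite SK -ge0_integralZl//; last 3 first.
  + exact/measurable_EFinP.
  + by move=> x _; rewrite lee_fin sqr_ge0.
  + by rewrite lee_fin invr_ge0 exprn_ge0// enorm_ge0.
  rewrite le_eqVlt; apply/orP; left; apply/eqP; congr (_ * _)%E.
  apply: eq_integral => x _; rewrite -EFinM; congr EFin.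
  by rewrite /A !normcM normc_conj normc_real ger0_norm ?sqr_ge0//; ring.
- apply: (@le_trans _ _ ((S^-1 * enorm q ^- 2 / 2)%:E *
    (S%:E * \int[mu2]_x (normc (B q x) ^+ 2)%:E))%E).
    by apply: lee_wpmul2l => //; exact: bessel.
  rewrite SK -ge0_integralZl//; last 3 first.
  + exact/measurable_EFinP.
  + by move=> x _; rewrite lee_fin sqr_ge0.
  + by rewrite lee_fin invr_ge0 exprn_ge0// enorm_ge0.
  rewrite le_eqVlt; apply/orP; left; apply/eqP; congr (_ * _)%E.
  apply: eq_integral => x _; rewrite -EFinM; congr EFin.
  by rewrite /B !normcM normc_conj; ring.
Qed.

Let mn2 (u : R2 -> R[i]) : cmeasurable_fun setT u ->
  measurable_fun setT (fun x => normc (u x) ^+ 2).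
Proof. by move=> mu; apply: measurable_funX; exact: measurable_normc. Qed.

Let mexpn k : measurable_fun setT (fun x : R2 => enorm x ^+ k).
Proof. by apply: measurable_funX; exact: measurable_enorm. Qed.

Let mexpV k : measurable_fun setT (fun t : R => t ^- k).
Proof. by apply: (measurableT_comp (@measurable_inv R)); exact: measurable_funX. Qed.

(** The weights combine to (|x|^2 / |y|^4) (|y|^6 / |x|^6) |x|^4 = |y|^2, harmless against a
    compactly supported [g]. *)
Let test_part_lty : (\int[mu2]_q \int[mu2]_x (enorm q ^- 6 *
       ((normc (f x) ^+ 2 * enorm x ^+ 4) * normc (g (vdiv x q)) ^+ 2))%:E < +oo)%E.
Proof.
rewrite (@ge0_integral_weighted_dilation R (fun t => t ^- 6)
  (fun x => normc (f x) ^+ 2 * enorm x ^+ 4) (fun y => normc (g y) ^+ 2)).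
- apply: (@le_lt_trans _ _ (\int[mu2]_y \int[mu2]_x ((normc (f x) ^+ 2 * enorm x ^+ 0) *
    (normc (g y) ^+ 2 * enorm y ^+ 2))%:E)%E); last first.
    apply: ge0_integral_tensor_lty.
    + by apply: measurable_funM => //; exact: mn2.
    + by apply: measurable_funM => //; exact: mn2.
    + by move=> x; rewrite mulr_ge0 ?exprn_ge0 ?normc_ge0 ?enorm_ge0.
    + by move=> x; rewrite mulr_ge0 ?exprn_ge0 ?normc_ge0 ?enorm_ge0.
    + exact: test_function_integral_lty.
    + exact: test_function_integral_lty.
  rewrite le_eqVlt; apply/orP; left; apply/eqP.
  apply: eq_integral => y _; apply: eq_integral => x _; congr EFin.
  have [->|x0] := eqVneq x (0, 0); first by rewrite f0 normc0 sqr0 !(mul0r, mulr0).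
  have [->|y0] := eqVneq y (0, 0); first by rewrite g0 normc0 sqr0 !(mul0r, mulr0).
  by field; rewrite !enorm_eq0 x0 y0.
- exact: mexpV.
- by apply: measurable_funM => //; exact: mn2.
- exact: mn2.
- by move=> t; rewrite invr_ge0 (exprn_even_ge0 t (isT : ~~ odd 6)).
- by move=> x; rewrite mulr_ge0 ?exprn_ge0 ?normc_ge0 ?enorm_ge0.
- by move=> x; rewrite sqr_ge0.
- by rewrite f0 normc0 sqr0 mul0r.
- by rewrite g0 normc0 sqr0.
Qed.

(** The weights combine to (|x|^2 / |y|^4) (|y|^2 / |x|^2) = |y|^-2: the factor in [x] is the
    squared norm, the factor in [y] the admissibility integral. *)
Let psi_part_lty : (\int[mu2]_q \int[mu2]_x (enorm q ^- 2 *
       (normc (psi0 x) ^+ 2 * normc (psi0 (vdiv x q)) ^+ 2))%:E < +oo)%E.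
Proof.
rewrite (@ge0_integral_weighted_dilation R (fun t => t ^- 2)
  (fun x => normc (psi0 x) ^+ 2) (fun y => normc (psi0 y) ^+ 2)).
- apply: (@le_lt_trans _ _ (\int[mu2]_y \int[mu2]_x (normc (psi0 x) ^+ 2 *
    (normc (psi0 y) ^+ 2 / enorm y ^+ 2))%:E)%E); last first.
    apply: ge0_integral_tensor_lty => //.
    + exact: mn2.
    + apply: measurable_funM; first exact: mn2.
      exact: (measurableT_comp (@mexpV 2) (@measurable_enorm R _ _ id _)).
    + by move=> x; rewrite sqr_ge0.
    + by move=> x; rewrite mulr_ge0 ?sqr_ge0.
  rewrite le_eqVlt; apply/orP; left; apply/eqP.
  apply: eq_integral => y _; apply: eq_integral => x _; congr EFin.
  have [->|x0] := eqVneq x (0, 0); first by rewrite psi00 normc0 sqr0 !(mul0r, mulr0).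
  have [->|y0] := eqVneq y (0, 0); first by rewrite psi00 normc0 sqr0 !(mul0r, mulr0).
  by field; rewrite !enorm_eq0 x0 y0.
- exact: mexpV.
- exact: mn2.
- exact: mn2.
- by move=> t; rewrite invr_ge0 sqr_ge0.
- by move=> x; rewrite sqr_ge0.
- by move=> x; rewrite sqr_ge0.
- by rewrite psi00 normc0 sqr0.
- by rewrite psi00 normc0 sqr0.
Qed.

Let iG : cintegrable (mu2 \x mu2)%E setT G.
Proof.
apply: (@cintegrable_prod R _ _ _ _ mu2 mu2 G mG).
have mfg (h : R2 * R2 -> \bar R) : measurable_fun setT h -> (forall z, (0 <= h z)%E) ->
    measurable_fun setT (fun x : R2 => \int[mu2]_y h (x, y))%E.
  by move=> mh h0; exact: (@measurable_fun_fubini_tonelli_F _ _ _ _ _ mu2 h mh h0).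
pose h1 (z : R2 * R2) : \bar R := (enorm z.1 ^- 6 *
       ((normc (f z.2) ^+ 2 * enorm z.2 ^+ 4) * normc (g (vdiv z.2 z.1)) ^+ 2))%:E.
pose h2 (z : R2 * R2) : \bar R := (enorm z.1 ^- 2 *
       (normc (psi0 z.2) ^+ 2 * normc (psi0 (vdiv z.2 z.1)) ^+ 2))%:E.
have me1 k : measurable_fun setT (fun z : R2 * R2 => enorm z.1 ^- k).
  by apply: (measurableT_comp (@mexpV k)); exact: measurable_enorm.
have mvd : measurable_fun setT (fun z : R2 * R2 => vdiv z.2 z.1) by exact: measurable_vdiv.
have mh1 : measurable_fun setT h1.
  apply/measurable_EFinP/measurable_funM => //; apply: measurable_funM.
    apply: measurable_funM; first exact: (measurableT_comp (mn2 mf)).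
    exact: (measurableT_comp (@mexpn 4)).
  exact: (measurableT_comp (mn2 mg) mvd).
have mh2 : measurable_fun setT h2.
  apply/measurable_EFinP/measurable_funM => //; apply: measurable_funM.
    exact: (measurableT_comp (mn2 mpsi0)).
  exact: (measurableT_comp (mn2 mpsi0) mvd).
have h10 z : (0 <= h1 z)%E.
  by rewrite lee_fin mulr_ge0// !mulr_ge0 ?exprn_ge0 ?normc_ge0 ?enorm_ge0.
have h20 z : (0 <= h2 z)%E by rewrite lee_fin mulr_ge0// mulr_ge0 ?sqr_ge0.
apply: (@le_lt_trans _ _ (\int[mu2]_q ((2^-1)%:E *
  (\int[mu2]_x h1 (q, x) + \int[mu2]_x h2 (q, x))))%E).
  apply: ge0_le_integral => //.
  - by move=> q _; apply: integral_ge0 => p _; rewrite lee_fin normc_ge0.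
  - apply: (mfg (fun z => (normc (G z))%:E)).
      by apply/measurable_EFinP; exact: measurable_normc.
    by move=> z; rewrite lee_fin normc_ge0.
  - by apply: measurable_funeM; apply: emeasurable_funD; apply: mfg.
rewrite ge0_integralZl//; last 2 first.
- by apply: emeasurable_funD; apply: mfg.
- by move=> q _; rewrite adde_ge0//; apply: integral_ge0.
apply: lte_mul_pinfty => //.
rewrite ge0_integralD//; last 4 first.
- by move=> q _; apply: integral_ge0.
- exact: mfg.
- by move=> q _; apply: integral_ge0.
- exact: mfg.
by apply: lte_add_pinfty.
Qed.

Let K (z : R2 * R2) : R[i] :=
  (enorm z.1 ^- 4)%:C * (A z.1 z.2 * (B z.1 z.2)^*).

(** The integrand [K] in the coordinates (x, y) with y = x/q, where |q|^-4 reads |y|^4 / |x|^4. *)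
Let Phi (z : R2 * R2) : R[i] := (enorm z.2 ^+ 4 / enorm z.1 ^+ 4)%:C *
  ((f z.1)^* * (enorm z.1 ^+ 2)%:C * g z.2 * ((psi0 z.1)^* * psi0 z.2)^*).

Let mK : cmeasurable_fun setT K.
Proof.
apply: cmeasurableM.
  apply: cmeasurable_real; apply: (measurableT_comp (@mexpV 4)).
  exact: measurable_enorm.
by apply: cmeasurableM => //; exact: cmeasurable_conj.
Qed.

Let mPhi : cmeasurable_fun setT Phi.
Proof.
apply: cmeasurableM.
  apply: cmeasurable_real; apply: measurable_funM.
    exact: (measurableT_comp (@mexpn 4)).
  apply: (measurableT_comp (@mexpV 4)); exact: measurable_enorm.
apply: cmeasurableM; first apply: cmeasurableM; first apply: cmeasurableM.
- by apply: cmeasurable_conj; exact: (cmeasurable_comp mf measurable_fst).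
- by apply: cmeasurable_real; exact: (measurableT_comp (@mexpn 2)).
- exact: (cmeasurable_comp mg measurable_snd).
- apply: cmeasurable_conj; apply: cmeasurableM.
    by apply: cmeasurable_conj; exact: (cmeasurable_comp mpsi0 measurable_fst).
  exact: (cmeasurable_comp mpsi0 measurable_snd).
Qed.

Let KE (z : R2 * R2) : K z = Phi (z.2, vdiv z.2 z.1).
Proof.
case: z => q x; rewrite /K /Phi /A /B /=.
have [->|x0] := eqVneq x (0, 0); first by rewrite f0 rmorph0 !(mul0r, mulr0).
have [->|q0] := eqVneq q (0, 0); first by rewrite vdivr0 g0 !(mul0r, mulr0).
congr (_ * _); congr (_%:C); rewrite enorm_vdiv.
by field; rewrite !enorm_eq0 q0 x0.
Qed.

(** Here the weights cancel: (|x|^2 / |y|^4) (|y|^4 / |x|^4) |x|^2 = 1. What remains is the product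
    of the integrals of |f psi0| and |psi0 g|, finite since all factors are square-integrable. *)
Let iK : cintegrable (mu2 \x mu2)%E setT K.
Proof.
apply: (@cintegrable_prod R _ _ _ _ mu2 mu2 K mK).
rewrite (_ : (fun q => _) = (fun q => \int[mu2]_x (enorm q ^- 4 *
    ((normc (f x) * normc (psi0 x) * enorm x ^+ 2) *
     (normc (g (vdiv x q)) * normc (psi0 (vdiv x q)))))%:E)%E); last first.
  apply/funext => q; apply: eq_integral => x _; congr EFin.
  rewrite /K /A /B /= !normcM !normc_conj !normcM !normc_conj !normc_real.
  by rewrite !ger0_norm//; [ring|rewrite sqr_ge0].
have m1 (u : R2 -> R[i]) : cmeasurable_fun setT u -> measurable_fun setT (fun x => normc (u x)).
  exact: measurable_normc.
rewrite (@ge0_integral_weighted_dilation R (fun t => t ^- 4)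
  (fun x => normc (f x) * normc (psi0 x) * enorm x ^+ 2)
  (fun y => normc (g y) * normc (psi0 y))).
- apply: (@le_lt_trans _ _ (\int[mu2]_y \int[mu2]_x ((normc ((f x)^* * psi0 x)) *
    (normc ((psi0 y)^* * g y)))%:E)%E); last first.
    have lty (u v : R2 -> R[i]) : cmeasurable_fun setT u -> cmeasurable_fun setT v ->
        (\int[mu2]_x (normc (u x) ^+ 2)%:E < +oo)%E ->
        (\int[mu2]_x (normc (v x) ^+ 2)%:E < +oo)%E ->
        (\int[mu2]_x (normc ((u x)^* * v x))%:E < +oo)%E.
      move=> mu mv uoo voo; apply: cintegrable_normc_lty => //.
      apply: cintegrable_mul => //; first exact: cmeasurable_conj.
      by under eq_integral do rewrite normc_conj.
    have tlty (u : R2 -> R[i]) : test_function u ->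
        (\int[mu2]_x (normc (u x) ^+ 2)%:E < +oo)%E.
      move=> tu; have := test_function_integral_lty 0 tu.
      by under eq_integral do rewrite expr0 mulr1.
    apply: ge0_integral_tensor_lty.
    + by apply: m1; apply: cmeasurableM => //; exact: cmeasurable_conj.
    + by apply: m1; apply: cmeasurableM => //; exact: cmeasurable_conj.
    + by move=> x; exact: normc_ge0.
    + by move=> x; exact: normc_ge0.
    + by apply: lty => //; exact: tlty.
    + by apply: lty => //; exact: tlty.
  rewrite le_eqVlt; apply/orP; left; apply/eqP.
  apply: eq_integral => y _; apply: eq_integral => x _; congr EFin.
  rewrite !normcM !normc_conj.
  have [->|x0] := eqVneq x (0, 0); first by rewrite f0 normc0 !(mul0r, mulr0).
  have [->|y0] := eqVneq y (0, 0); first by rewrite g0 normc0 !(mul0r, mulr0).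
  by field; rewrite !enorm_eq0 x0 y0.
- exact: mexpV.
- by apply: measurable_funM => //; apply: measurable_funM; exact: m1.
- by apply: measurable_funM; exact: m1.
- by move=> t; rewrite invr_ge0 (exprn_even_ge0 t (isT : ~~ odd 4)).
- by move=> x; rewrite !mulr_ge0 ?normc_ge0 ?sqr_ge0.
- by move=> x; rewrite !mulr_ge0 ?normc_ge0.
- by rewrite f0 normc0 !mul0r.
- by rewrite g0 normc0 mul0r.
Qed.

Let cvdiv q : continuous (fun x : R2 => vdiv x q).
Proof.
have cM (a b c : R) : continuous (fun x : R2 => (x.1 * a + x.2 * b) * c).
  move=> x; apply: cvgMr_tmp; apply: cvgD; apply: cvgMr_tmp.
    exact: cvg_fst.
  exact: cvg_snd.
rewrite (_ : (fun x => _) = (fun x : R2 =>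
   ((x.1 * q.1 + x.2 * q.2) * (enorm q ^+ 2)^-1,
    (x.1 * - q.2 + x.2 * q.1) * (enorm q ^+ 2)^-1))); last first.
  by apply/funext => x; rewrite vdivE; congr (_, _ * _); ring.
move=> x; exact: (cvg_pair (@cM q.1 q.2 _ x) (@cM (- q.2) q.1 _ x)).
Qed.

Let cenorm2 : continuous (fun x : R2 => enorm x ^+ 2).
Proof.
under eq_fun do rewrite sqr_enorm !expr2.
move=> x; apply: cvgD; apply: cvgM; (exact: cvg_fst || exact: cvg_snd).
Qed.

(** [A q] contains test functions only, so it takes the role of the continuous factor in [parseval],
    leaving [B q] as the merely integrable one. *)
Let cA q : continuous (fun x : R2 => complex.Re (A q x)) /\
  continuous (fun x : R2 => complex.Im (A q x)).
Proof.
have [cfr cfi] := test_function_continuous tf.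
have [cgr cgi] := test_function_continuous tg.
have cgr' : continuous (fun x : R2 => complex.Re (g (vdiv x q))).
  by move=> x; exact: (cvg_comp _ _ (@cvdiv q x) (cgr (vdiv x q))).
have cgi' : continuous (fun x : R2 => complex.Im (g (vdiv x q))).
  by move=> x; exact: (cvg_comp _ _ (@cvdiv q x) (cgi (vdiv x q))).
split.
- rewrite (_ : (fun x => _) = (fun x : R2 => enorm x ^+ 2 *
    (complex.Re (f x) * complex.Re (g (vdiv x q)) +
     complex.Im (f x) * complex.Im (g (vdiv x q))))); last first.
    apply/funext => x; rewrite /A !cReM !cImM cRe_conj cIm_conj /=; ring.
  move=> x; apply: cvgM; first exact: cenorm2.
  by apply: cvgD; apply: cvgM; [exact: cfr|exact: cgr'|exact: cfi|exact: cgi'].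
- rewrite (_ : (fun x => _) = (fun x : R2 => enorm x ^+ 2 *
    (complex.Re (f x) * complex.Im (g (vdiv x q)) -
     complex.Im (f x) * complex.Re (g (vdiv x q))))); last first.
    apply/funext => x; rewrite /A !cImM !cReM cRe_conj cIm_conj /=; ring.
  move=> x; apply: cvgM; first exact: cenorm2.
  by apply: cvgB; apply: cvgM; [exact: cfr|exact: cgi'|exact: cfi|exact: cgr'].
Qed.

Let A_bounded q : exists M, forall x, normc (A q x) <= M.
Proof.
have [M M0 fM] := test_function_bounded tf; have [N N0 gN] := test_function_bounded tg.
exists (M * (M + M) ^+ 2 * N) => x; rewrite /A !normcM normc_conj normc_real.
have [->|fx] := eqVneq (f x) 0.
  by rewrite normc0 !mul0r !mulr_ge0// addr_ge0.
have [nM /(_ fx) [x1 x2]] := fM x; have [nN _] := gN (vdiv x q).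
rewrite (ger0_norm (sqr_ge0 _)) ler_pM ?mulr_ge0 ?normc_ge0 ?sqr_ge0//.
rewrite ler_pM ?normc_ge0 ?sqr_ge0// lerXn2r ?nnegrE ?enorm_ge0 ?addr_ge0//.
by rewrite (le_trans (normc_le_ReIm _))// lerD.
Qed.

(** Restricted to almost every [q] because the slices of [G] are known to be integrable only
    there. *)
Let inner_parseval :
  {ae mu2, forall q, cintegral mu2 setT (fun p => G (q, p)) =
                     cintegral mu2 setT (fun x => K (q, x))}.
Proof.
have [iGr iGi] := iG.
have aer := @ae_integrable1 _ _ _ _ R mu2 mu2 _ iGr.
have aei := @ae_integrable1 _ _ _ _ R mu2 mu2 _ iGi.
apply: filterS2 aer aei => q ir ii.
have [->|q0] := eqVneq q (0, 0).
  apply: eq_cintegral => p _; rewrite G0 /K /= enorm0 expr0n (_ : 0 ^-1 = 0); last exact: invr0.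
  by rewrite (rmorph0 (real_complex R)) mul0r.
have nq0 : enorm q != 0 by rewrite enorm_eq0.
have c0 : S^-1 * enorm q ^- 4 != 0.
  by rewrite mulf_neq0 ?invr_neq0//; [rewrite gt_eqF|rewrite expf_neq0].
have iq : cintegrable mu2 setT (fun p => G (q, p)) by split.
(* The prefactor of [G] is a nonzero constant at fixed [q]; dividing by it gives the integrability
   that [parseval] asks for. *)
have iFF : cintegrable mu2 setT (fun p => FT (A q) p * (FT (B q) p)^*).
  have := cintegrableZ measurableT (S^-1 * enorm q ^- 4)^-1%:C iq.
  apply: eq_cintegrable => // p _; rewrite /G [(_, _).1]/= [(_, _).2]/= mulrA -realcM.
  by rewrite mulVf// mul1r.
have iAB : cintegrable mu2 setT (fun x => A q x * (B q x)^*).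
  have [M AM] := A_bounded q.
  apply: (@cintegrable_boundM _ _ _ mu2 setT measurableT _ _ M) => //.
  - by apply: cintegrable_conj => //; exact: iB.
  - exact: (cintegrable_measurable measurableT (iA q0)).
have [M AM] := A_bounded q; have [cAr cAi] := cA q.
transitivity ((S^-1 * enorm q ^- 4)%:C * cintegral mu2 setT (fun p => FT (A q) p * (FT (B q) p)^*)).
  by rewrite -cintegralZ.
rewrite (parseval cAr cAi AM (iA q0) (iB q0) iFF).
transitivity ((enorm q ^- 4)%:C * cintegral mu2 setT (fun x => A q x * (B q x)^*)); last first.
  by rewrite -cintegralZ.
rewrite mulrA -realcM; congr (_%:C * _).
by rewrite mulrAC mulVf ?mul1r// gt_eqF.
Qed.

Let Phi_change : cintegral (mu2 \x mu2)%E setT K =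
  cintegral (mu2 \x mu2)%E setT (fun z => ((f z.1)^* * psi0 z.1) * ((psi0 z.2)^* * g z.2)).
Proof.
transitivity (cintegral (mu2 \x mu2)%E setT (fun z => Phi (z.2, vdiv z.2 z.1))).
  by apply: eq_cintegral => z _; rewrite KE.
rewrite (@cintegral_change_of_variables R _ _ _ _ (mu2 \x mu2)%E (mu2 \x mu2)%E
  (fun z => (z.2, vdiv z.2 z.1)) (fun z => enorm z.1 ^+ 2 / enorm z.2 ^+ 4)
  [set z | z.2 = (0, 0)]); first last.
- by move=> -[x y] /= ->; rewrite /Phi /= g0 !(mulr0, mul0r).
- exact: mPhi.
- move=> h mh h0 hZ.
  have mw : measurable_fun setT (fun z : R2 * R2 => (enorm z.1 ^+ 2 / enorm z.2 ^+ 4)%:E * h z)%E.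
    apply: emeasurable_funM => //; apply/measurable_EFinP/measurable_funM.
      exact: (measurableT_comp (@mexpn 2)).
    by apply: (measurableT_comp (@mexpV 4)); exact: measurable_enorm.
  have w0 z : (0 <= (enorm z.1 ^+ 2 / enorm z.2 ^+ 4)%:E * h z)%E.
    by rewrite mule_ge0// lee_fin mulr_ge0 ?sqr_ge0.
  (* Tonelli turns both product integrals into iterated ones, to which the dilation formula applies
     because [h] vanishes at y = 0. *)
  rewrite (@ge0_tonelli_plane R (fun z => h (z.2, vdiv z.2 z.1)))//; last first.
    apply: (measurableT_comp mh); apply: measurable_fun_pair => //.
    exact: measurable_vdiv.
  rewrite (@ge0_tonelli_plane R (fun z => ((enorm z.1 ^+ 2 / enorm z.2 ^+ 4)%:E * h z)%E))//.
  rewrite (ge0_fubini_plane mw w0).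
  rewrite -ge0_integral_dilation// => x; exact: hZ.
- by move=> z; rewrite mulr_ge0 ?sqr_ge0.
apply: eq_cintegral => -[x y] _; rewrite /Phi [(_, _).1]/= [(_, _).2]/=.
have [->|x0] := eqVneq x (0, 0); first by rewrite f0 rmorph0 !(mul0r, mulr0).
have [->|y0] := eqVneq y (0, 0); first by rewrite g0 !(mul0r, mulr0).
rewrite conjcM conjCK.
transitivity ((enorm x ^+ 2 / enorm y ^+ 4 * (enorm y ^+ 4 / enorm x ^+ 4) * enorm x ^+ 2)%:C *
  ((f x)^* * g y * psi0 x * (psi0 y)^*)); first by rewrite !realcM; ring.
(* Jacobian, |q|^-4 and the |x|^2 coming from C^-1 twice cancel exactly, so the variables
   separate. *)
rewrite (_ : _ * _ * _ = 1); last by field; rewrite !enorm_eq0 x0 y0.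
by rewrite (rmorph1 (real_complex R)); ring.
Qed.

Let itest (u : R2 -> R[i]) : test_function u ->
  (\int[mu2]_x (normc (u x) ^+ 2)%:E < +oo)%E.
Proof.
by move=> tu; have := test_function_integral_lty 0 tu;
  under eq_integral do rewrite expr0 mulr1.
Qed.

Let i_fpsi : cintegrable mu2 setT (fun x => (f x)^* * psi0 x).
Proof.
apply: cintegrable_mul => //; first exact: cmeasurable_conj.
by under eq_integral do rewrite normc_conj; exact: itest.
Qed.

Let i_psig : cintegrable mu2 setT (fun x => (psi0 x)^* * g x).
Proof.
apply: cintegrable_mul => //; first exact: cmeasurable_conj.
  by under eq_integral do rewrite normc_conj.
exact: itest.
Qed.

Let integralG : cintegral (mu2 \x mu2)%E setT G =
  cintegral mu2 setT (fun x => (f x)^* * psi0 x) *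
  cintegral mu2 setT (fun x => (psi0 x)^* * g x).
Proof.
rewrite -(@cintegral12 R _ _ _ _ mu2 mu2 G iG).
transitivity (cintegral mu2 setT (fun q => cintegral mu2 setT (fun x => K (q, x)))).
  apply: ae_eq_cintegral.
  - exact: (@cmeasurable_cintegral_plane R G).
  - exact: (@cmeasurable_cintegral_plane R K).
  - exact: inner_parseval.
rewrite (@cintegral12 R _ _ _ _ mu2 mu2 K iK) Phi_change.
have it : cintegrable (mu2 \x mu2)%E setT
   (fun z => ((f z.1)^* * psi0 z.1) * ((psi0 z.2)^* * g z.2)).
  have := @cintegrable_tensor_plane R (fun=> 1) (fun x => (f x)^* * psi0 x)
    (fun x => (psi0 x)^* * g x) 1 _ _ i_fpsi i_psig.
  move=> h; have h1 (z : R2 * R2) : normc (1 : R[i]) <= 1 by rewrite normc1.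
  have := h (cmeasurable_cst _ _) h1.
  by apply: eq_cintegrable => // z _; rewrite mul1r.
rewrite -(@cintegral12 R _ _ _ _ mu2 mu2 _ it).
transitivity (cintegral mu2 setT (fun x => cintegral mu2 setT (fun x => (psi0 x)^* * g x) *
   ((f x)^* * psi0 x))).
  by apply: eq_cintegral => x _; rewrite /= cintegralZ// mulrC.
by rewrite cintegralZ// mulrC.
Qed.

Lemma weak_integral_ketbra :
  cintegrable (@lebesgueGamma R) (@Gamma R) F /\
  cintegral (@lebesgueGamma R) (@Gamma R) F = braket f (ketbra psi psi g).
Proof.
have mGam : measurable (@Gamma R).
  by apply: measurableX => //; exact: measurable_R2star.
(* The complement of [Gamma] is the slice q = 0, where [G] vanishes. *)
have FG : zero_ext (@Gamma R) F = G.
  apply/funext => -[q p]; rewrite /zero_ext GE; case: ifPn => // qN.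
  rewrite (_ : q = (0, 0)) ?G0//.
  apply/eqP; apply: contraNT qN => q0; rewrite inE; split => //.
split.
  by apply: cintegrable_mkcond => //; rewrite FG; exact: iG.
rewrite cintegral_mkcond FG.
transitivity (cintegral (mu2 \x mu2)%E setT G); first by [].
rewrite integralG /braket /ketbra [RHS]cintegral_mkcond.
transitivity (cintegral mu2 setT (fun x => cintegral mu2 setT (fun x => (psi0 x)^* * g x) *
   ((f x)^* * psi0 x))).
  by rewrite cintegralZ// mulrC.
have -> : braket psi g = cintegral mu2 setT (fun x => (psi0 x)^* * g x).
  rewrite /braket cintegral_mkcond; apply: eq_cintegral => x _.
  rewrite /psi0 /zero_ext; case: ifPn => // _; by rewrite rmorph0 mul0r.
apply: eq_cintegral => x _; rewrite /psi0 /zero_ext; case: ifPn => _.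
  by rewrite /braket; ring.
by rewrite !mulr0.
Qed.

End WeakIntegral.

(** * The trace formula *)

Section TraceFormula.
Variable R : realType.
Local Notation R2 := (R * R)%type.
Local Notation mu2 := (@lebesgue2 R).
Local Notation D := (@R2star R).
Implicit Types u v w : R2 -> R[i].

Let mD : measurable D := @measurable_R2star R.

Lemma L2_integrable u v : L2 u -> L2 v ->
  cintegrable mu2 D (fun x => (u x)^* * v x).
Proof.
move=> [mu uoo] [mv voo]; apply: cintegrable_mul => //; first exact: cmeasurable_conj.
by under eq_integral do rewrite normc_conj.
Qed.

Lemma L2Z u (c : R[i]) : L2 u -> L2 (fun x => c * u x).
Proof.
move=> [mu uoo]; split; first by apply: cmeasurableM => //; exact: cmeasurable_cst.
under eq_integral do rewrite normcM exprMn EFinM.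
rewrite ge0_integralZl//.
- by apply: lte_mul_pinfty => //; rewrite lee_fin sqr_ge0.
- by apply/measurable_EFinP/measurable_funX; exact: measurable_normc.
- by move=> x _; rewrite lee_fin sqr_ge0.
- by rewrite lee_fin sqr_ge0.
Qed.

Lemma L2D u v : L2 u -> L2 v -> L2 (fun x => u x + v x).
Proof.
move=> [mu uoo] [mv voo]; split; first exact: cmeasurableD.
have mn2 w : cmeasurable_fun D w ->
    measurable_fun D (fun x => (2 * normc (w x) ^+ 2)%:E).
  move=> mw; apply/measurable_EFinP; apply: measurable_funM => //.
  by apply: measurable_funX; exact: measurable_normc.
have n0 w x : (0 <= (2 * normc (w x) ^+ 2)%:E)%E by rewrite lee_fin mulr_ge0// sqr_ge0.
have oo w : cmeasurable_fun D w -> (\int[mu2]_(x in D) (normc (w x) ^+ 2)%:E < +oo)%E ->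
    (\int[mu2]_(x in D) (2 * normc (w x) ^+ 2)%:E < +oo)%E.
  move=> mw woo; under eq_integral do rewrite EFinM.
  rewrite ge0_integralZl//.
  - exact: lte_mul_pinfty.
  - by apply/measurable_EFinP/measurable_funX; exact: measurable_normc.
  - by move=> x _; rewrite lee_fin sqr_ge0.
apply: (@le_lt_trans _ _ (\int[mu2]_(x in D) ((2 * normc (u x) ^+ 2)%:E +
    (2 * normc (v x) ^+ 2)%:E))%E).
  apply: ge0_le_integral => //.
  - by move=> x _; rewrite lee_fin sqr_ge0.
  - by apply/measurable_EFinP/measurable_funX/measurable_normc; exact: cmeasurableD.
  - by apply: emeasurable_funD; exact: mn2.
  - move=> x _; rewrite -EFinD lee_fin.
    apply: (@le_trans _ _ ((normc (u x) + normc (v x)) ^+ 2)).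
      by rewrite lerXn2r ?nnegrE ?addr_ge0 ?normc_ge0// le_normcD.
    have := sqr_ge0 (normc (u x) - normc (v x)).
    by rewrite sqrrB sqrrD => h; lra.
rewrite ge0_integralD//; first by apply: lte_add_pinfty; exact: oo.
- exact: mn2.
- exact: mn2.
Qed.

Lemma L2_sum n (c : nat -> R[i]) (e : nat -> R2 -> R[i]) : (forall i, L2 (e i)) ->
  L2 (fun x => \sum_(i < n) c i * e i x).
Proof.
move=> Le; elim: n => [|n IHn].
  under eq_fun do rewrite big_ord0.
  have := L2Z 0 (Le 0%N); congr L2.
  by apply/funext => x; rewrite mul0r.
under eq_fun do rewrite big_ord_recr /=.
by apply: L2D => //; exact: L2Z.
Qed.

Lemma braket_conjC u v : L2 u -> L2 v -> braket v u = (braket u v)^*.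
Proof.
move=> Lu Lv; rewrite /braket -cintegral_conj//; last exact: L2_integrable.
by apply: eq_cintegral => x _; rewrite conjcM conjCK mulrC.
Qed.

Lemma braketZr u v (c : R[i]) : L2 u -> L2 v ->
  braket u (fun x => c * v x) = c * braket u v.
Proof.
move=> Lu Lv; rewrite /braket -cintegralZ//; last exact: L2_integrable.
by apply: eq_cintegral => x _; ring.
Qed.

Lemma braketDr u v w : L2 u -> L2 v -> L2 w ->
  braket u (fun x => v x + w x) = braket u v + braket u w.
Proof.
move=> Lu Lv Lw; rewrite /braket -cintegralD//; try exact: L2_integrable.
by apply: eq_cintegral => x _; rewrite mulrDr.
Qed.

Lemma braket_sumr u n (c : nat -> R[i]) (e : nat -> R2 -> R[i]) :
  L2 u -> (forall i, L2 (e i)) ->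
  braket u (fun x => \sum_(i < n) c i * e i x) = \sum_(i < n) c i * braket u (e i).
Proof.
move=> Lu Le; elim: n => [|n IHn].
  rewrite big_ord0 (_ : (fun x => _) = (fun x => 0 * e 0%N x)).
    by rewrite braketZr// mul0r.
  by apply/funext => x; rewrite big_ord0 mul0r.
rewrite big_ord_recr /= -IHn -braketZr// -braketDr//.
- by congr braket; apply/funext => x; rewrite big_ord_recr.
- exact: L2_sum.
- exact: L2Z.
Qed.

Definition sqnorm u : R := Rintegral mu2 D (fun x => normc (u x) ^+ 2).

Lemma sqnorm_ge0 u : 0 <= sqnorm u.
Proof. by apply: Rintegral_ge0 => x _; rewrite sqr_ge0. Qed.

Lemma braket_sqnorm u : braket u u = (sqnorm u)%:C.
Proof.
by rewrite /sqnorm -cintegral_real; apply: eq_cintegral => x _; rewrite conj_mulc.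
Qed.

Lemma sqnorm_integrable u : L2 u ->
  mu2.-integrable D (EFin \o (fun x => normc (u x) ^+ 2)).
Proof.
move=> [mu uoo]; apply/integrableP; split.
  by apply/measurable_EFinP/measurable_funX; exact: measurable_normc.
by under eq_integral do rewrite /= ger0_norm ?sqr_ge0//.
Qed.

(** A weighted AM-GM inequality replaces Cauchy-Schwarz: a small [d] tames the fixed [u] provided
    that [v] is of squared size d^2. *)
Lemma le_braket_sqnorm u v (d : R) : L2 u -> L2 v -> 0 < d ->
  `|complex.Re (braket u v)| <= d * sqnorm u + d^-1 * sqnorm v /\
  `|complex.Im (braket u v)| <= d * sqnorm u + d^-1 * sqnorm v.
Proof.
move=> Lu Lv d0; have iu := sqnorm_integrable Lu; have iv := sqnorm_integrable Lv.
have [ir ii] := L2_integrable Lu Lv.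
have iZ (c : R) (h : R2 -> R) : mu2.-integrable D (EFin \o h) ->
    mu2.-integrable D (EFin \o (fun x => c * h x)).
  by move=> ih; have := @integrableZl _ _ _ mu2 D mD c _ ih.
have E : d * sqnorm u + d^-1 * sqnorm v =
    Rintegral mu2 D (fun x => d * normc (u x) ^+ 2 + d^-1 * normc (v x) ^+ 2).
  by rewrite RintegralD// ?RintegralZl//; exact: iZ.
have i2 : mu2.-integrable D
    (EFin \o (fun x => d * normc (u x) ^+ 2 + d^-1 * normc (v x) ^+ 2)).
  have := @integrableD _ _ _ mu2 D mD _ _ (iZ d _ iu) (iZ d^-1 _ iv).
  by apply: eq_integrable.
have le x : normc ((u x)^* * v x) <= d * normc (u x) ^+ 2 + d^-1 * normc (v x) ^+ 2.
  rewrite normcM normc_conj.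
  have h : 0 <= d * normc (u x) ^+ 2 + d^-1 * normc (v x) ^+ 2.
    by rewrite addr_ge0// mulr_ge0 ?sqr_ge0 ?invr_ge0// ltW.
  suff : 0 <= d * normc (u x) ^+ 2 + d^-1 * normc (v x) ^+ 2 -
      2 * (normc (u x) * normc (v x)).
    by have := mulr_ge0 (normc_ge0 (u x)) (normc_ge0 (v x)); lra.
  rewrite (_ : _ - _ = d^-1 * (d * normc (u x) - normc (v x)) ^+ 2).
    by rewrite mulr_ge0 ?sqr_ge0// invr_ge0 ltW.
  by field; rewrite gt_eqF.
rewrite E; split; apply: (le_trans (le_normr_Rintegral _ _)) => //;
  apply: le_Rintegral => //.
- exact: integrable_norm.
- by move=> x _; rewrite (le_trans (normr_Re_le _)).
- exact: integrable_norm.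
- by move=> x _; rewrite (le_trans (normr_Im_le _)).
Qed.

(** Pythagoras: the cross terms vanish and the square of [v] is dropped. *)
Lemma sqnorm_orthogonal_le u v : L2 u -> L2 v -> braket u v = 0 ->
  sqnorm u <= sqnorm (fun x => u x + v x).
Proof.
move=> Lu Lv uv0; have Luv := L2D Lu Lv.
have vu0 : braket v u = 0 by rewrite (braket_conjC Lu Lv) uv0 rmorph0.
suff : (sqnorm (fun x => u x + v x))%:C = (sqnorm u)%:C + (sqnorm v)%:C.
  rewrite -(rmorphD (real_complex R)) => /complexI ->.
  by rewrite lerDl sqnorm_ge0.
(* Linearity is at hand in the second slot; conjugation moves the remaining sums there. *)
rewrite -!braket_sqnorm braketDr// (braket_conjC Lu Luv) (braket_conjC Lv Luv).
by rewrite !braketDr// uv0 vu0 addr0 add0r -!braket_conjC.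
Qed.

(** * Expansions in an orthonormal basis *)

Section OrthonormalBasis.
Variable e : nat -> R2 -> R[i].
Hypothesis be : orthonormal_basis e.

Let Le i : L2 (e i). Proof. by case: be. Qed.

(** [v] minus its projection onto the first [n] basis vectors; the sign sits in the coefficients so
    that it is again a linear combination. *)
Let residual v n x := v x + \sum_(i < n) - braket (e i) v * e i x.

Let L2_residual v n : L2 v -> L2 (residual v n).
Proof.
move=> Lv; apply: L2D => //.
exact: (@L2_sum n (fun i => - braket (e i) v) e).
Qed.

Let residual_orthogonal v n j : L2 v -> (j < n)%N -> braket (e j) (residual v n) = 0.
Proof.
move=> Lv jn; have [_ on _] := be.
rewrite /residual braketDr//; last exact: (@L2_sum n (fun i => - braket (e i) v) e).
rewrite (@braket_sumr _ n (fun i => - braket (e i) v) e)//.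
rewrite (bigD1 (Ordinal jn))//= on eqxx mulr1 big1 ?addr0 ?subrr// => i ij.
rewrite on (_ : (j == i) = false) ?mulr0//.
by apply: contraNF ij => /eqP h; apply/eqP/val_inj.
Qed.

(** The two approximations differ by [s], a combination of the first [n] vectors and so orthogonal
    to the residual. Allowing m <= n turns one good combination into a bound for all later [n]. *)
Let residual_best v n m (c : nat -> R[i]) : L2 v -> (m <= n)%N ->
  sqnorm (residual v n) <= sqnorm (fun x => v x - \sum_(i < m) c i * e i x).
Proof.
move=> Lv mn; have Lr := L2_residual n Lv.
pose s x := \sum_(i < m) - c i * e i x + \sum_(i < n) braket (e i) v * e i x.
have Ls1 : L2 (fun x => \sum_(i < m) - c i * e i x).
  exact: (@L2_sum m (fun i => - c i) e).
have Ls2 : L2 (fun x => \sum_(i < n) braket (e i) v * e i x).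
  exact: (@L2_sum n (fun i => braket (e i) v) e).
have Ls : L2 s by exact: L2D.
have -> : (fun x => v x - \sum_(i < m) c i * e i x) = (fun x => residual v n x + s x).
  apply/funext => x.
  have N k (a : nat -> R[i]) : \sum_(i < k) - a i * e i x = - \sum_(i < k) a i * e i x.
    by rewrite -sumrN; apply: eq_bigr => i _; rewrite mulNr.
  rewrite /residual /s (N m c) (N n (fun i => braket (e i) v)); ring.
apply: sqnorm_orthogonal_le => //.
have ro j : (j < n)%N -> braket (residual v n) (e j) = 0.
  by move=> jn; rewrite (braket_conjC (Le j) Lr) residual_orthogonal// rmorph0.
rewrite braketDr//.
rewrite (@braket_sumr _ m (fun i => - c i) e)// (@braket_sumr _ n (fun i => braket (e i) v) e)//.
rewrite !big1 ?addr0// => i _; rewrite ro ?mulr0//.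
exact: leq_trans (ltn_ord i) mn.
Qed.

Lemma parseval_orthonormal_basis u v : L2 u -> L2 v ->
  ccvg (fun n => \sum_(i < n) braket u (e i) * braket (e i) v) (braket u v).
Proof.
move=> Lu Lv.
have rE n : braket u v - \sum_(i < n) braket u (e i) * braket (e i) v =
    braket u (residual v n).
  rewrite /residual braketDr//; last exact: (@L2_sum n (fun i => - braket (e i) v) e).
  rewrite (@braket_sumr _ n (fun i => - braket (e i) v) e)// -sumrN.
  by congr (_ + _); apply: eq_bigr => i _; rewrite mulNr mulrC.
have small (eps : R) : 0 < eps -> \forall n \near \oo,
    `|complex.Re (braket u (residual v n))| < eps /\
    `|complex.Im (braket u (residual v n))| < eps.
  (* With a residual of squared norm at most d^2 the bound is d (sqnorm u + 1), strictly below [eps]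
     thanks to the 2. *)
  move=> eps0; pose d := eps / (sqnorm u + 2).
  have d0 : 0 < d by rewrite divr_gt0// ltr_wpDl// sqnorm_ge0.
  have [_ _ /(_ v d Lv d0) [m [c vm]]] := be.
  exists m => // n /= mn.
  have small2 : sqnorm (residual v n) <= d ^+ 2.
    apply: (le_trans (residual_best c Lv mn)).
    move: vm; rewrite /L2norm -/(sqnorm _) => /ltW vm.
    by rewrite -(sqr_sqrtr (sqnorm_ge0 _)) lerXn2r ?nnegrE ?sqrtr_ge0// ltW.
  have b : d * sqnorm u + d^-1 * sqnorm (residual v n) < eps.
    apply: (@le_lt_trans _ _ (d * (sqnorm u + 1))).
      rewrite mulrDr lerD2l mulr1 mulrC ler_pdivrMr// -expr2//.
    rewrite /d mulrAC ltr_pdivrMr; last by rewrite ltr_wpDl// sqnorm_ge0.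
    by rewrite ltr_pM2l// ltrD2l ltr1n.
  have [h1 h2] := le_braket_sqnorm Lu (L2_residual n Lv) d0.
  by split; [exact: le_lt_trans h1 b|exact: le_lt_trans h2 b].
split; apply/cvgrPdist_lt => eps eps0; have := small _ eps0; apply: filterS => n [h1 h2].
- move: h1; rewrite -rE; case: (braket u v) => a1 b1; case: (\sum_(i < n) _) => a2 b2.
  by [].
- move: h2; rewrite -rE; case: (braket u v) => a1 b1; case: (\sum_(i < n) _) => a2 b2.
  by [].
Qed.

End OrthonormalBasis.

Lemma L2_U (q p : R2) (psi : R2 -> R[i]) : q != (0, 0) -> L2 psi -> L2 (U q p psi).
Proof.
move=> q0 Lpsi; have [m0 f0] := L2_zero_ext Lpsi.
(* Extending [psi] by 0 makes the composite with x/q measurable on the whole plane; on [D] nothing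
   changes, as x/q stays nonzero. *)
pose u x := expi (dotp p x) / (enorm q)%:C * zero_ext D psi (vdiv x q).
have uE : {in D, u =1 U q p psi}.
  move=> x; rewrite inE /R2star /= => x0.
  by rewrite /u /U /zero_ext mem_set//; exact: vdiv_neq0.
have mz : cmeasurable_fun setT (fun x => zero_ext D psi (vdiv x q)).
  by apply: (cmeasurable_comp m0); exact: measurable_vdiv.
have me : cmeasurable_fun setT (fun x => expi (dotp p x) / (enorm q)%:C).
  by apply: cmeasurableM; [exact: cmeasurable_expi_dotp|exact: cmeasurable_cst].
have mu : cmeasurable_fun setT u by exact: cmeasurableM.
split.
  apply: (eq_cmeasurable uE); have [mr mi] := mu.
  by split; [exact: measurable_funTS mr|exact: measurable_funTS mi].
rewrite (_ : integral _ _ _ = \int[mu2]_(x in D) (normc (u x) ^+ 2)%:E)%E; last first.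
  by apply: eq_integral => x xD; rewrite uE.
have mnu : measurable_fun setT (fun x => (normc (u x) ^+ 2)%:E).
  by apply/measurable_EFinP/measurable_funX; exact: measurable_normc.
apply: (@le_lt_trans _ _ (\int[mu2]_x (normc (u x) ^+ 2)%:E)%E).
  by apply: ge0_subset_integral => // x _; rewrite lee_fin sqr_ge0.
under eq_integral do rewrite /u normcM exprMn normcM normc_expi mul1r EFinM.
rewrite ge0_integralZl//.
- apply: lte_mul_pinfty => //; first by rewrite lee_fin sqr_ge0.
  exact: integral_vdiv_lty.
- by apply/measurable_EFinP/measurable_funX; exact: measurable_normc.
- by move=> x _; rewrite lee_fin sqr_ge0.
- by rewrite lee_fin sqr_ge0.
Qed.

Lemma function_of_ketbra (psi : R2 -> R[i]) : L2 psi -> function_of (ketbra psi psi) (varpi psi).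
Proof.
move=> Lpsi q p q0; have LU := L2_U p q0 Lpsi.
exists (braket psi (U q p psi)); last first.
  by rewrite /varpi (braket_conjC Lpsi LU) mulrC (fmorphV (real_complex R)).
move=> e be; have Le i : L2 (e i) by case: be.
have E n : \sum_(i < n) braket (e i) ((U q p \o ketbra psi psi) (e i)) =
    \sum_(i < n) braket psi (e i) * braket (e i) (U q p psi).
  (* The operator has rank one: U(q,p) applied to a multiple of [psi] is the same multiple of U(q,p)
     psi. *)
  apply: eq_bigr => i _; rewrite -braketZr//; congr braket.
  by apply/funext => x; rewrite /U /ketbra /=; ring.
under eq_fun do rewrite E; under [X in _ /\ (X @ _ --> _)]eq_fun do rewrite E.
exact: parseval_orthonormal_basis.
Qed.

End TraceFormula.

Theorem proposition5p1 (R : realType) (psi : R * R -> R[i]) :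
  L2 psi -> L2norm psi = 1 -> admissible psi ->
  operator_of (varpi psi) (ketbra psi psi) /\
  function_of (ketbra psi psi) (varpi psi).
Proof.
move=> Lpsi _ apsi; split; last exact: function_of_ketbra.
by move=> f g tf tg; exact: weak_integral_ketbra.
Qed.
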